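(* Consider either the multi-indexed Laguerre case (L) or the multi-indexed Jacobi case (J). Let $\mathcal D$ be a multi-index and $\mathcal N\ge1$ an integer. For every $\mathcal D'\in\mathcal{EP}$ the following identity of polynomials in $\eta$ holds: $$\Xi_{\mathcal D}(\eta)\Bigl(\widetilde{\mathcal H}_{\mathcal D}P_{\mathcal D',\mathcal N}(\eta)-\widetilde{\mathcal E}(\mathcal D')\,P_{\mathcal D',\mathcal N}(\eta)\Bigr)=\mathcal E'(\mathcal D')\,P_{\mathcal D,\mathcal N}(\eta)\,\Xi_{\mathcal D'}(\eta),$$ where the constants are - type I ($d_j^{\rm I}$ replaced by $\epsilon$): $\widetilde{\mathcal E}(\mathcal D')=\widetilde{\mathcal E}^{\rm I}(d_j^{\rm I})+\widetilde{\mathcal E}^{\rm I}(\epsilon)-\mathcal E(\mathcal N)$ and $\mathcal E'(\mathcal D')=2\bigl(\mathcal E(\mathcal N)-\widetilde{\mathcal E}^{\rm I}(\epsilon)\bigr)$; - type II ($d_j^{\rm II}$ replaced by $\epsilon$): $\widetilde{\mathcal E}(\mathcal D')=\widetilde{\mathcal E}^{\rm II}(d_j^{\rm II})+\widetilde{\mathcal E}^{\rm II}(\epsilon)-\mathcal E(\mathcal N)$ and $\mathcal E'(\mathcal D')=2\bigl(\mathcal E(\mathcal N)-\widetilde{\mathcal E}^{\rm II}(\epsilon)\bigr)$; - type III ($d_j^{\rm I}$ and $d_k^{\rm II}$ removed): $\widetilde{\mathcal E}(\mathcal D')=\widetilde{\mathcal E}^{\rm I}(d_j^{\rm I})+\widetilde{\mathcal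 E}^{\rm II}(d_k^{\rm II})-\mathcal E(\mathcal N)$ and $\mathcal E'(\mathcal D')=-8$ in case L, $\mathcal E'(\mathcal D')=-32$ in case J.
   Context: **Multi-index and parameters.** $\mathcal D=\mathcal D^{\rm I}\cup\mathcal D^{\rm II}$, $\mathcal D^{\rm I}=\{d_1^{\rm I}<\dots<d_M^{\rm I}\}$, $\mathcal D^{\rm II}=\{d_1^{\rm II}<\dots<d_N^{\rm II}\}$, positive integers, $M,N\ge0$, $M+N\ge1$ (the labels I and II are part of the data). Real parameters: $g$ in case L, with $g>\max\{N+\frac32,\,d_j^{\rm II}+\frac12\}$; $(g,h)$ in case J, with $g>\max\{N+2,\,d_j^{\rm II}+\frac12\}$, $h>\max\{M+2,\,d_j^{\rm I}+\frac12\}$. **Energies.** L: $\mathcal E(n)=4n$, $\widetilde{\mathcal E}^{\rm I}({\rm v})=-4(g+{\rm v}+\frac12)$, $\widetilde{\mathcal E}^{\rm II}({\rm v})=-4(g-{\rm v}-\frac12)$. J: $\mathcal E(n)=4n(n+g+h)$, $\widetilde{\mathcal E}^{\rm I}({\rm v})=-4(g+{\rm v}+\frac12)(h-{\rm v}-\frac12)$, $\widetilde{\mathcal E}^{\rm II}({\rm v})=-4(g-{\rm v}-\frac12)(h+{\rm v}+\frac12)$. **Polynomials.** $P_n=L_n^{(g-1/2)}$ (Laguerre, L), $P_n=P_n^{(g-1/2,h-1/2)}$ (Jacobi, J). For an integer ${\rm v}\ge 0$ put - L: $\mu^{\rm I}_{\rm v}(\eta)=e^{\eta}L^{(g-1/2)}_{\rm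 v}(-\eta)$, $\ \mu^{\rm II}_{\rm v}(\eta)=\eta^{1/2-g}L^{(1/2-g)}_{\rm v}(\eta)$; - J: $\mu^{\rm I}_{\rm v}(\eta)=\bigl(\frac{1+\eta}2\bigr)^{1/2-h}P^{(g-1/2,1/2-h)}_{\rm v}(\eta)$, $\ \mu^{\rm II}_{\rm v}(\eta)=\bigl(\frac{1-\eta}2\bigr)^{1/2-g}P^{(1/2-g,h-1/2)}_{\rm v}(\eta)$. ${\rm W}[f_1,\dots,f_r]=\det(d^{i-1}f_j/d\eta^{i-1})_{1\le i,j\le r}$ ($=1$ for $r=0$). For an index pair $\mathcal A=(a_1,\dots,a_p;b_1,\dots,b_q)$ (distinct non-negative integers $a_i$ of type I, distinct non-negative integers $b_i$ of type II) define the polynomials $$\Xi_{\mathcal A}(\eta)={\rm W}[\mu^{\rm I}_{a_1},\dots,\mu^{\rm I}_{a_p},\mu^{\rm II}_{b_1},\dots,\mu^{\rm II}_{b_q}]\times\begin{cases}\eta^{(p+g-\frac12)q}e^{-p\eta}&\text{L}\\ \bigl(\frac{1-\eta}2\bigr)^{(p+g-\frac12)q}\bigl(\frac{1+\eta}2\bigr)^{(q+h-\frac12)p}&\text{J}\end{cases}$$ $$P_{\mathcal A,n}(\eta)={\rm W}[\mu^{\rm I}_{a_1},\dots,\mu^{\rm I}_{a_p},\mu^{\rm II}_{b_1},\dots,\mu^{\rm II}_{b_q},P_n]\times\begin{cases}\eta^{(p+g+\frac12)q}e^{-p\eta}&\text{L}\\ \bigl(\frac{1-\eta}2\bigr)^{(p+g+\frac12)q}\bigl(\frac{1+\eta}2\bigr)^{(q+h+\frac12)p}&\text{J}\end{cases}$$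 (formulas read on $0<\eta<\infty$ for L, $-1<\eta<1$ for J). $\mathcal D$ is identified with $(d^{\rm I}_1,\dots,d^{\rm I}_M;d^{\rm II}_1,\dots,d^{\rm II}_N)$. **Differential operator.** $c_2(\eta)=\eta$ (L), $1-\eta^2$ (J). Put $c_1(\eta;g)=g+\frac12-\eta$ (L), $c_1(\eta;g,h)=h-g-(g+h+1)\eta$ (J). Let $C_1$ be $c_1$ with parameters shifted to $g+M-N$ (L), $(g+M-N,h-M+N)$ (J), and $C_1^-$ be $c_1$ with parameters $g+M-N-1$ (L), $(g+M-N-1,h-M+N-1)$ (J). Then $$\widetilde{\mathcal H}_{\mathcal D}=-4\Bigl(c_2\frac{d^2}{d\eta^2}+\Bigl(C_1-2c_2\frac{\Xi_{\mathcal D}'}{\Xi_{\mathcal D}}\Bigr)\frac{d}{d\eta}+c_2\frac{\Xi_{\mathcal D}''}{\Xi_{\mathcal D}}-C_1^-\frac{\Xi_{\mathcal D}'}{\Xi_{\mathcal D}}\Bigr).$$ **The set $\mathcal{EP}$** consists of the following index pairs $\mathcal D'$: - type I: $\mathcal D$ with one entry $d_j^{\rm I}$ replaced (in the same position) by some integer $\epsilon$ with $0\le\epsilon<d_j^{\rm I}$, $\epsilon\notin\mathcal D^{\rm I}$; - type II: $\mathcal D$ with one entry $d_j^{\rm II}$ replaced (in the same position) by some integer $\epsilon$ with $0\le\epsilon<d_j^{\rm II}$, $\epsilon\notin\mathcal D^{\rm II}$; - type III: $\mathcal D$ with one entry $d_j^{\rm I}$ and one entry $d_k^{\rm II}$ both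 removed. *)

(* Defs.v *)
From HB Require Import structures.
From mathcomp Require Import all_boot all_order all_algebra fraction.
From mathcomp Require Import all_classical all_reals all_analysis.
Import Order.TTheory GRing.Theory Num.Theory.
Import numFieldNormedType.Exports.

Set Implicit Arguments.
Unset Strict Implicit.
Unset Printing Implicit Defensive.

Local Open Scope ring_scope.

(* The constructor is the case, L or J; its arguments are g, resp. g and h. *)
Inductive params (R : Type) := Laguerre of R | Jacobi of R & R.

(* The labels I and II are carried by the field; the order of the entries
   matters, as it fixes the signs of the Wronskians below. *)
Record index_pair := IndexPair { typeI : seq nat; typeII : seq nat }.

Definition multi_index (D : index_pair) : Prop :=
  [/\ sorted ltn (typeI D), sorted ltn (typeII D),
      all (leq 1) (typeI D), all (leq 1) (typeII D)
    & (1 <= size (typeI D) + size (typeII D))%N].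

Definition admissible (R : realType) (c : params R) (D : index_pair) : Prop :=
  let M := size (typeI D) in
  let N := size (typeII D) in
  match c with
  | Laguerre g =>
      N%:R + 3 / 2 < g /\ (forall d, d \in typeII D -> d%:R + 1 / 2 < g)
  | Jacobi g h =>
      [/\ N%:R + 2 < g, (forall d, d \in typeII D -> d%:R + 1 / 2 < g),
          M%:R + 2 < h & (forall d, d \in typeI D -> d%:R + 1 / 2 < h)]
  end.

Definition dom (R : realType) (c : params R) (x : R) : Prop :=
  match c with
  | Laguerre _ => 0 < x
  | Jacobi _ _ => -1 < x < 1
  end.

Definition energy (R : realType) (c : params R) (n : nat) : R :=
  match c with
  | Laguerre _ => 4 * n%:R
  | Jacobi g h => 4 * n%:R * (n%:R + g + h)
  end.

Definition energyI (R : realType) (c : params R) (v : nat) : R :=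
  match c with
  | Laguerre g => - 4 * (g + v%:R + 1 / 2)
  | Jacobi g h => - 4 * (g + v%:R + 1 / 2) * (h - v%:R - 1 / 2)
  end.

Definition energyII (R : realType) (c : params R) (v : nat) : R :=
  match c with
  | Laguerre g => - 4 * (g - v%:R - 1 / 2)
  | Jacobi g h => - 4 * (g - v%:R - 1 / 2) * (h + v%:R + 1 / 2)
  end.

(* a (a - 1) ... (a - k + 1) / k!, for real a *)
Definition gbinom (R : realType) (a : R) (k : nat) : R :=
  (\prod_(i < k) (a - i%:R)) / (k`!)%:R.

Definition laguerre (R : realType) (alpha : R) (n : nat) : {poly R} :=
  \sum_(k < n.+1)
    ((-1) ^+ k * gbinom (n%:R + alpha) (n - k) / (k`!)%:R) *: 'X^k.

(* This expression makes sense, and is the analytic continuation of the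
   classical polynomials, for all real alpha and beta. *)
Definition jacobi (R : realType) (alpha beta : R) (n : nat) : {poly R} :=
  \sum_(s < n.+1)
    (gbinom (n%:R + alpha) (n - s) * gbinom (n%:R + beta) s) *:
      ((2^-1 *: ('X - 1)) ^+ s * (2^-1 *: ('X + 1)) ^+ (n - s)).

Definition eigenP (R : realType) (c : params R) (n : nat) : {poly R} :=
  match c with
  | Laguerre g => laguerre (g - 1 / 2) n
  | Jacobi g h => jacobi (g - 1 / 2) (h - 1 / 2) n
  end.

Definition muI (R : realType) (c : params R) (v : nat) : R -> R :=
  fun x => match c with
  | Laguerre g => expR x * (laguerre (g - 1 / 2) v).[- x]
  | Jacobi g h =>
      ((1 + x) / 2) `^ (1 / 2 - h) * (jacobi (g - 1 / 2) (1 / 2 - h) v).[x]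
  end.

Definition muII (R : realType) (c : params R) (v : nat) : R -> R :=
  fun x => match c with
  | Laguerre g => x `^ (1 / 2 - g) * (laguerre (1 / 2 - g) v).[x]
  | Jacobi g h =>
      ((1 - x) / 2) `^ (1 / 2 - g) * (jacobi (1 / 2 - g) (h - 1 / 2) v).[x]
  end.

Definition wronskian (R : realType) (fs : seq (R -> R)) : R -> R :=
  fun x => \det (\matrix_(i < size fs, j < size fs)
                   derive1n i (nth (fun=> 0) fs j) x).

Definition seeds (R : realType) (c : params R) (A : index_pair) :
    seq (R -> R) :=
  map (muI c) (typeI A) ++ map (muII c) (typeII A).

(* Closed formulas for Xi_A and P_{A,n}; they are meaningful on [dom c] only,
   since the real power is not the intended one at nonpositive arguments. *)
Definition Xi_fun (R : realType) (c : params R) (A : index_pair) : R -> R :=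
  let p : R := (size (typeI A))%:R in
  let q : R := (size (typeII A))%:R in
  fun x => wronskian (seeds c A) x *
    match c with
    | Laguerre g => x `^ ((p + g - 1 / 2) * q) * expR (- p * x)
    | Jacobi g h => ((1 - x) / 2) `^ ((p + g - 1 / 2) * q) *
                    ((1 + x) / 2) `^ ((q + h - 1 / 2) * p)
    end.

Definition P_fun (R : realType) (c : params R) (A : index_pair) (n : nat) :
    R -> R :=
  let p : R := (size (typeI A))%:R in
  let q : R := (size (typeII A))%:R in
  fun x => wronskian (rcons (seeds c A) (horner (eigenP c n))) x *
    match c with
    | Laguerre g => x `^ ((p + g + 1 / 2) * q) * expR (- p * x)
    | Jacobi g h => ((1 - x) / 2) `^ ((p + g + 1 / 2) * q) *
                    ((1 + x) / 2) `^ ((q + h + 1 / 2) * p)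
    end.

(* Since [dom c] is infinite, at most one polynomial satisfies this. *)
Definition poly_of (R : realType) (c : params R) (f : R -> R) (p : {poly R}) :
    Prop :=
  forall x, dom c x -> p.[x] = f x.

Definition c2 (R : realType) (c : params R) : {poly R} :=
  match c with
  | Laguerre _ => 'X
  | Jacobi _ _ => 1 - 'X^2
  end.

Definition c1 (R : realType) (c : params R) : {poly R} :=
  match c with
  | Laguerre g => (g + 1 / 2)%:P - 'X
  | Jacobi g h => (h - g)%:P - (g + h + 1) *: 'X
  end.

Definition shift (R : realType) (c : params R) (a b : R) : params R :=
  match c with
  | Laguerre g => Laguerre (g + a)
  | Jacobi g h => Jacobi (g + a) (h + b)
  end.

Definition C1 (R : realType) (c : params R) (D : index_pair) : {poly R} :=
  let M : R := (size (typeI D))%:R in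
  let N : R := (size (typeII D))%:R in
  c1 (shift c (M - N) (- M + N)).

Definition C1m (R : realType) (c : params R) (D : index_pair) : {poly R} :=
  let M : R := (size (typeI D))%:R in
  let N : R := (size (typeII D))%:R in
  c1 (shift c (M - N - 1) (- M + N - 1)).

Notation "x %:F" := (@FracField.tofrac _ x) : ring_scope.

(* The operator, with rational functions as coefficients, applied to a
   polynomial P; X stands for the polynomial Xi_D. *)
Definition Htilde (R : realType) (c : params R) (D : index_pair)
    (X P : {poly R}) : {fraction {poly R}} :=
  - 4 * ((c2 c)%:F * (P^`(2))%:F
         + ((C1 c D)%:F - 2 * (c2 c)%:F * ((X^`())%:F / X%:F))
             * (P^`())%:F
         + ((c2 c)%:F * ((X^`(2))%:F / X%:F)
            - (C1m c D)%:F * ((X^`())%:F / X%:F)) * P%:F).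

(* The elements of the set EP attached to D are coded by the modification of D
   that produces them. As the entries of each type in D are distinct, an entry
   is designated by its value, and distinct valid modifications give distinct
   index pairs. *)
Inductive modification :=
  | ReplaceI (d e : nat)
  | ReplaceII (d e : nat)
  | RemoveBoth (dI dII : nat).

Definition in_EP (D : index_pair) (m : modification) : bool :=
  match m with
  | ReplaceI d e => [&& d \in typeI D, (e < d)%N & e \notin typeI D]
  | ReplaceII d e => [&& d \in typeII D, (e < d)%N & e \notin typeII D]
  | RemoveBoth dI dII => (dI \in typeI D) && (dII \in typeII D)
  end.

Definition replace (d e : nat) (s : seq nat) : seq nat :=
  [seq if x == d then e else x | x <- s].

Definition modify (D : index_pair) (m : modification) : index_pair :=
  match m with
  | ReplaceI d e => IndexPair (replace d e (typeI D)) (typeII D)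
  | ReplaceII d e => IndexPair (typeI D) (replace d e (typeII D))
  | RemoveBoth dI dII => IndexPair (rem dI (typeI D)) (rem dII (typeII D))
  end.

Definition Etilde (R : realType) (c : params R) (n : nat) (m : modification) :
    R :=
  match m with
  | ReplaceI d e => energyI c d + energyI c e - energy c n
  | ReplaceII d e => energyII c d + energyII c e - energy c n
  | RemoveBoth dI dII => energyI c dI + energyII c dII - energy c n
  end.

Definition Eprime (R : realType) (c : params R) (n : nat) (m : modification) :
    R :=
  match m with
  | ReplaceI d e => 2 * (energy c n - energyI c e)
  | ReplaceII d e => 2 * (energy c n - energyII c e)
  | RemoveBoth _ _ => match c with Laguerre _ => - 8 | Jacobi _ _ => - 32 end
  end.

(* Main.v *)
Require Import Defs.
From HB Require Import structures.
From mathcomp Require Import all_boot all_order all_algebra fraction.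
From mathcomp Require Import all_classical all_reals all_analysis.
From mathcomp Require Import perm ring lra zify.
Import Order.TTheory GRing.Theory Num.Theory.
Import numFieldNormedType.Exports.

(**
All the functions entering the Wronskians satisfy [c2 f'' + c1 f' = k f] with
[k] equal to [-1/4] times the attached energy.  Applying this operator
to the columns of a Wronskian [W = |0, ..., m|] (rows are orders of
differentiation) gives
  [c2 (|0, ..., m-1, m+2| - |0, ..., m-2, m, m+1|) + (m c2' + c1) W' + s W = (sum k) W],
while the sum of the two determinants on the left is [W''].  This trades
[W''] for a single determinant in the bilinear expression
[W V'' - 2 W' V' + W'' V], whose remaining part is a Laplace expansion: with [S]
the common columns, it equals [W[S] W[S,d,e,n]].  For type III this is the
right-hand side; for types I and II the same differential equation and the
Plücker relations express it through [W[S,d] W[S,e,n]] and [W[S,e] W[S,d,n]].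
The prefactors only change the coefficients of this bilinear identity, which
then holds on the whole domain, hence between polynomials.

That the Wronskians times their prefactors are polynomials comes from a pole
count at each singular endpoint [z = 0]: once row [i] is multiplied by [z^i], a
regular column is divisible by [z^i] in row [i], and a column of exponent
[b] is a combination of powers [z^l] with coefficient vectors depending only on [l].
Expanding, columns of the same kind have to pick distinct powers of [z].
*)

Set Implicit Arguments.
Unset Strict Implicit.
Unset Printing Implicit Defensive.

Local Open Scope ring_scope.

(** * Bilinear identities between minors *)

Section Det.
Variable K : comPzRingType.
Implicit Types (n m : nat) (f : nat -> nat -> K).

(** Entries are indexed by natural numbers, so that rows and columns can be shifted, replaced or
    skipped without casts between ordinals. *)
Definition detn n f : K := \det (\matrix_(i < n, j < n) f i j).

Definition setrow k (g : nat -> K) f := fun i j => if i == k then g j else f i j.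

Lemma eq_detn n f g :
  (forall i j, (i < n)%N -> (j < n)%N -> f i j = g i j) -> detn n f = detn n g.
Proof. by move=> fg; congr (\det _); apply/matrixP => i j; rewrite !mxE fg. Qed.

Lemma detn_tr n f : detn n (fun i j => f j i) = detn n f.
Proof. by rewrite /detn -det_tr; congr (\det _); apply/matrixP => i j; rewrite !mxE. Qed.

Lemma detn_eqrow n f i k : (i < n)%N -> (k < n)%N -> i != k ->
  (forall j, (j < n)%N -> f i j = f k j) -> detn n f = 0.
Proof.
move=> lin lkn ik fik.
apply: (@determinant_alternate _ _ _ (Ordinal lin) (Ordinal lkn)) => //.
by move=> j; rewrite !mxE fik.
Qed.

Lemma detn_swap n f i k : (i < n)%N -> (k < n)%N -> i != k ->
  detn n (fun l => f (if l == i then k else if l == k then i else l)) = - detn n f.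
Proof.
move=> lin lkn ik; pose s := tperm (Ordinal lin) (Ordinal lkn).
have -> : - detn n f = \det (perm_mx s) * detn n f.
  by rewrite det_perm odd_tperm -val_eqE /= ik expr1 mulN1r.
rewrite /detn -det_mulmx -row_permE; congr (\det _); apply/matrixP => u v.
rewrite !mxE; congr (f _ _); rewrite permE /=.
by rewrite -!val_eqE /=; do 2?case: ifP.
Qed.

Lemma detn_setrow n f k (lkn : (k < n)%N) (h : nat -> K) :
  detn n (setrow k h f) = \sum_(j < n)
    h j * cofactor (\matrix_(i < n, j < n) f i j) (Ordinal lkn) j.
Proof.
rewrite /detn (expand_det_row _ (Ordinal lkn)); apply: eq_bigr => j _.
rewrite mxE /setrow eqxx; congr (_ * (_ * \det _)); apply/matrixP => u v.
rewrite !mxE; case: eqP => // /eqP; rewrite -[X in _ == X]/(val (Ordinal lkn)).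
by rewrite val_eqE eq_sym (negbTE (neq_lift _ _)).
Qed.

Lemma detn_setrow_lin n f k p (c : nat -> K) (g : nat -> nat -> K) : (k < n)%N ->
  detn n (setrow k (fun j => \sum_(l < p) c l * g l j) f)
  = \sum_(l < p) c l * detn n (setrow k (g l) f).
Proof.
move=> lkn; rewrite detn_setrow.
under [RHS]eq_bigr do rewrite (detn_setrow _ lkn) mulr_sumr.
rewrite exchange_big; apply: eq_bigr => j _.
by rewrite mulr_suml; apply: eq_bigr => l _; rewrite -mulrA.
Qed.

Lemma detn_lastrow n f :
  detn n.+1 f = \sum_(j < n.+1)
    f n j * ((-1) ^+ (n + j) * detn n (fun i l => f i (bump j l))).
Proof.
rewrite /detn (expand_det_row _ ord_max); apply: eq_bigr => j _.
rewrite mxE /=; congr (_ * (_ * \det _)); apply/matrixP => u v.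
by rewrite !mxE lift_max.
Qed.

(** This is the shape of both Laplace arguments below, where the last row is made to vanish on the
    first [m] columns and three terms of the expansion survive. *)
Lemma detn_lastrow3 m f : (forall j, (j < m)%N -> f m.+2 j = 0) ->
  detn m.+3 f = f m.+2 m * detn m.+2 (fun i l => f i (bump m l))
    - f m.+2 m.+1 * detn m.+2 (fun i l => f i (bump m.+1 l))
    + f m.+2 m.+2 * detn m.+2 f.
Proof.
move=> f0; rewrite detn_lastrow !big_ord_recr big1 => [|j _]; last first.
  by rewrite f0 ?mul0r //=.
have sgn j : (-1) ^+ (m.+2 + j) = (-1) ^+ (odd m (+) odd j) :> K.
  by rewrite -signr_odd oddD /= negbK.
rewrite /= !sgn /= negbK addbN addbb mul1r mulN1r mulrN add0r mul1r.
congr (_ + _ * _).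
by apply: eq_detn => i j _ lj; rewrite /bump leqNgt lj.
Qed.

(** * Minors on selected rows and Plücker relations *)

Implicit Types (S cs : seq (nat -> K)) (a b c d e : nat -> K) (rho : nat -> nat).

(** A column is the infinite sequence of derivatives of a function at a point; [rho] picks the
    orders of differentiation used as rows, and [rho = id] gives the Wronskian. *)
Definition minor rho cs : K :=
  detn (size cs) (fun i j => nth (fun=> 0) cs j (rho i)).

Lemma eq_minor rho rho' cs :
  (forall i, (i < size cs)%N -> rho i = rho' i) -> minor rho cs = minor rho' cs.
Proof. by move=> e; apply: eq_detn => i j li _; rewrite e. Qed.

Lemma minor_eqrow rho cs i k : (i < size cs)%N -> (k < size cs)%N ->
  i != k -> rho i = rho k -> minor rho cs = 0.
Proof. by move=> li lk ik e; apply: (detn_eqrow li lk ik) => j _; rewrite e. Qed.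

Definition minor_cof rho S (i : nat) : K :=
  (-1) ^+ (size S + i) *
    detn (size S) (fun u j => nth (fun=> 0) S j (rho (bump i u))).

Lemma minor_rcons rho S a : minor rho (rcons S a) =
  \sum_(i < (size S).+1) minor_cof rho S i * a (rho i).
Proof.
rewrite /minor size_rcons -detn_tr detn_lastrow; apply: eq_bigr => i _.
rewrite nth_rcons ltnn eqxx mulrC -detn_tr; congr (_ * _ * _).
by apply: eq_detn => u j _ lj; rewrite nth_rcons lj.
Qed.

Lemma minor_swap rho S1 a b S2 :
  minor rho (S1 ++ a :: b :: S2) = - minor rho (S1 ++ b :: a :: S2).
Proof.
have -> : minor rho (S1 ++ b :: a :: S2) = detn (size (S1 ++ a :: b :: S2))
    (fun i j => nth (fun=> 0) (S1 ++ b :: a :: S2) j (rho i)).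
  by rewrite /minor !size_cat.
rewrite /minor -[LHS]detn_tr -[in RHS]detn_tr.
rewrite -(@detn_swap _ _ (size S1) (size S1).+1); first last.
- by rewrite neq_ltn ltnSn.
- by rewrite size_cat /= !addnS !ltnS leq_addr.
- by rewrite size_cat /= !addnS !ltnS leqW // leq_addr.
apply: eq_detn => i j _ _; rewrite !nth_cat; case: (ltngtP i (size S1)) => [li|li|->].
- by rewrite (ltn_eqF (leqW li)) li.
- case: eqP => [->|/eqP ne]; first by rewrite ltnn subnn subSnn.
  have [k ->] : exists k, i = (size S1 + k.+2)%N.
    exists (i - (size S1).+2)%N; rewrite -!addSnnS subnKC //.
    by rewrite ltn_neqAle eq_sym ne.
  by rewrite ltnNge leq_addr addKn.
- by rewrite subnn ltnNge leqnSn /= subSnn.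
Qed.

Lemma minor_move rho S1 a S2 S3 :
  minor rho (S1 ++ a :: S2 ++ S3) =
  (-1) ^+ size S2 * minor rho (S1 ++ S2 ++ a :: S3).
Proof.
elim: S2 S1 => [|b S2 IH] S1 /=; first by rewrite mul1r.
by rewrite minor_swap -cat_rcons IH cat_rcons exprS mulN1r mulNr.
Qed.

(** On [m + 1] columns [last1 m k] selects the rows 0, ..., m-1, k; on [m + 2] columns [last2 m k l]
    selects 0, ..., m-1, k, l. *)
Definition last1 m k i := if i == m then k else i.
Definition last2 m k l i := if i == m then k else if i == m.+1 then l else i.

Lemma minor_eqcol rho cs j k : (j < size cs)%N -> (k < size cs)%N -> j != k ->
  nth (fun=> 0) cs j = nth (fun=> 0) cs k -> minor rho cs = 0.
Proof.
move=> lj lk jk e; rewrite /minor -detn_tr.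
by apply: (detn_eqrow lj lk jk) => i _; rewrite e.
Qed.

Lemma minor_rcons_mem rho S j : (j < size S)%N ->
  minor rho (rcons S (nth (fun=> 0) S j)) = 0.
Proof.
move=> lj; apply: (@minor_eqcol _ _ j (size S)); rewrite ?size_rcons ?ltnS //.
- exact: ltnW.
- by rewrite ltn_eqF.
- by rewrite !nth_rcons lj ltnn eqxx.
Qed.

Lemma nth_cat_add S cs j :
  nth (fun=> 0) (S ++ cs) (size S + j)%N = nth (fun=> 0) cs j.
Proof. by rewrite nth_cat ltnNge leq_addr addKn. Qed.

Lemma nth_cat_bump S a b c j :
  [/\ nth (fun=> 0) (S ++ [:: a; b; c]) (bump (size S) j) =
         nth (fun=> 0) (S ++ [:: b; c]) j,
      nth (fun=> 0) (S ++ [:: a; b; c]) (bump (size S).+1 j) =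
        nth (fun=> 0) (S ++ [:: a; c]) j
    & (j < (size S).+2)%N -> nth (fun=> 0) (S ++ [:: a; b; c]) j =
        nth (fun=> 0) (S ++ [:: a; b]) j].
Proof.
rewrite /bump; have [lj|lj] := ltnP j (size S).
  by rewrite ltnNge (ltnW lj) /= !nth_cat !add0n lj.
have [k ->] : exists k, j = (size S + k)%N by exists (j - size S)%N; rewrite subnKC.
rewrite add1n -addnS !nth_cat_add; case: k => [|k].
  have -> : (size S < size S + 0)%N = false by rewrite addn0 ltnn.
  by rewrite add0n !nth_cat_add.
rewrite addnS ltnS leq_addr add1n -!addnS !nth_cat_add; split=> // lk.
by case: k lk => // k; rewrite !addnS !ltnS ltnNge leq_addr.
Qed.

(* Append to the rows 0, ..., size S + 1 of (S, d, e, c) the row of the minors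
   of (S, _), which vanishes on S, and expand the determinant along it. *)
Lemma minor_plucker rho S d e c :
  minor rho (rcons S d) * minor id (S ++ [:: e; c])
  - minor rho (rcons S e) * minor id (S ++ [:: d; c])
  + minor rho (rcons S c) * minor id (S ++ [:: d; e])
  = \sum_(i < (size S).+1) minor_cof rho S i *
      minor (last1 (size S).+2 (rho i)) (S ++ [:: d; e; c]).
Proof.
set m := size S; set F := fun i j => nth (fun=> 0) (S ++ [:: d; e; c]) j i.
transitivity (detn m.+3 (setrow m.+2
    (fun j => \sum_(i < m.+1) minor_cof rho S i * F (rho i) j) F)); last first.
  rewrite (@detn_setrow_lin _ _ _ _ (minor_cof rho S) (fun i => F (rho i))) //.
  apply: eq_bigr => i _; congr (_ * _).
  rewrite /minor size_cat /= addn3; apply: eq_detn => u j _ _.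
  by rewrite /setrow /last1; case: eqP.
have G j : \sum_(i < m.+1) minor_cof rho S i * F (rho i) j =
    minor rho (rcons S (nth (fun=> 0) (S ++ [:: d; e; c]) j)).
  by rewrite minor_rcons.
rewrite detn_lastrow3 => [|j lj]; last first.
  by rewrite /setrow eqxx G nth_cat lj minor_rcons_mem.
rewrite /setrow eqxx !G; have := nth_cat_add S [:: d; e; c].
move=> N; move: (N 0) (N 1) (N 2); rewrite addn0 addn1 addn2 => -> -> -> /=.
congr (_ * _ - _ * _ + _ * _); rewrite /minor size_cat addn2;
  apply: eq_detn => i j li lj; rewrite ltn_eqF //= /F;
  by have [E1 E2 E3] := nth_cat_bump S d e c j; rewrite ?E1 ?E2 ?E3.
Qed.

(** Every minor on the right of [minor_plucker] has the rows 0, ..., size S + 1 and one more row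
    [rho i], which is then a repetition. *)
Lemma minor_plucker0 rho S d e c :
    (forall i, (i <= size S)%N -> (rho i <= (size S).+1)%N) ->
  minor rho (rcons S d) * minor id (S ++ [:: e; c])
  - minor rho (rcons S e) * minor id (S ++ [:: d; c])
  + minor rho (rcons S c) * minor id (S ++ [:: d; e]) = 0.
Proof.
move=> lrho; rewrite minor_plucker big1 // => i _.
rewrite (@minor_eqrow _ _ (size S).+2 (rho i)) ?mulr0 ?size_cat ?addn3 //.
- by rewrite ltnS ltnW // ltnS lrho // -ltnS.
- by rewrite gtn_eqF // ltnS lrho // -ltnS.
- by rewrite /last1 eqxx ltn_eqF // ltnS lrho // -ltnS.
Qed.

Lemma minor_cof_last1 S k : minor_cof (last1 (size S) k) S (size S) = minor id S.
Proof.
rewrite /minor_cof addnn -mul2n exprM sqrrN expr1n expr1n mul1r.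
by apply: eq_detn => i j li _; rewrite /last1 /bump leqNgt li ltn_eqF.
Qed.

Lemma minor_last1_id S a : minor (last1 (size S) (size S)) (rcons S a) = minor id (rcons S a).
Proof. by apply: eq_minor => i _; rewrite /last1; case: eqP. Qed.

(** Among the selected rows only [m + 2] is not already present, so one term of [minor_plucker]
    survives; its cofactor is [minor id S]. *)
Lemma minor_plucker_top S d e c (m := size S) :
  minor (last1 m m.+2) (rcons S d) * minor id (S ++ [:: e; c])
  - minor (last1 m m.+2) (rcons S e) * minor id (S ++ [:: d; c])
  + minor (last1 m m.+2) (rcons S c) * minor id (S ++ [:: d; e])
  = minor id S * minor id (S ++ [:: d; e; c]).
Proof.
rewrite minor_plucker big_ord_recr big1 => [|[i li] _ /=]; last first.
  rewrite (@minor_eqrow _ _ (size S).+2 i) ?mulr0 ?size_cat ?addn3 //.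
  - by rewrite ltnS ltnW // ltnW // ltnS ltnW.
  - by rewrite gtn_eqF // ltnS ltnW // ltnS ltnW.
  - rewrite /last1 eqxx (ltn_eqF li) ltn_eqF //.
    by rewrite ltnS ltnW // ltnS ltnW.
rewrite /= add0r minor_cof_last1; congr (_ * _); apply: eq_minor => i _.
by rewrite /last1 eqxx; case: eqP.
Qed.

Lemma bump_last2 m j : (j < m.+2)%N ->
  bump m j = last2 m m.+1 m.+2 j /\ bump m.+1 j = last2 m m m.+2 j.
Proof.
rewrite /bump /last2 ltnS leq_eqVlt ltnS => /orP[/eqP->|].
  by rewrite leqnSn leqnn gtn_eqF // eqxx.
rewrite leq_eqVlt => /orP[/eqP->|lj]; first by rewrite leqnn ltnn eqxx.
by rewrite leqNgt lj ltnNge (ltnW lj) !ltn_eqF // leqW.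
Qed.

(* Dual to [minor_plucker]: here the column of the minors of (S, d), which
   vanishes on the rows 0, ..., m - 1, is appended to (S, e, c). *)
Lemma minor_laplace S d e c (m := size S) :
  minor id (rcons S d) * minor (last2 m m.+1 m.+2) (S ++ [:: e; c])
  - minor (last1 m m.+1) (rcons S d) * minor (last2 m m m.+2) (S ++ [:: e; c])
  + minor (last1 m m.+2) (rcons S d) * minor id (S ++ [:: e; c])
  = minor id S * minor id (S ++ [:: d; e; c]).
Proof.
pose F i j := nth (fun=> 0) (S ++ [:: e; c; d]) i j.
have N j : nth (fun=> 0) (S ++ [:: e; c; d]) (m + j) = nth (fun=> 0) [:: e; c; d] j.
  exact: nth_cat_add.
pose C j := (-1) ^+ (m + j) *
  detn m (fun i l => nth (fun=> 0) (rcons S d) (bump j l) i).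
have E k : minor (last1 m k) (rcons S d) =
    \sum_(l < m.+1) C l * nth (fun=> 0) (rcons S d) l k.
  rewrite /minor size_rcons detn_lastrow; apply: eq_bigr => j _.
  rewrite {1}/last1 eqxx mulrC; congr (_ * _ * _).
  by apply: eq_detn => u l lu _; rewrite /last1 ltn_eqF.
(* The matrix is transposed: its rows are S, e, c and, in place of d, the sequence of the minors of
   (S, d). *)
transitivity (detn m.+3 (setrow m.+2 (fun k => minor (last1 m k) (rcons S d)) F)).
  rewrite detn_lastrow3 => [|j lj]; last first.
    rewrite /setrow eqxx (@minor_eqrow _ _ j m) ?size_rcons ?ltnS //.
    - exact: ltnW.
    - by rewrite ltn_eqF.
    - by rewrite /last1 eqxx ltn_eqF.
  rewrite /setrow eqxx -minor_last1_id.
  congr (_ * _ - _ * _ + _ * _); rewrite /minor size_cat addn2 -[LHS]detn_tr;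
    apply: eq_detn => i j li lj; rewrite ltn_eqF // /F;
    have [_ _ ->] // := nth_cat_bump S e c d i.
  - by have [-> _] := bump_last2 lj.
  - by have [_ ->] := bump_last2 lj.
transitivity (detn m.+3 (setrow m.+2 (fun k =>
    \sum_(l < m.+1) C l * nth (fun=> 0) (rcons S d) l k) F)).
  by apply: eq_detn => i j _ _; rewrite /setrow E.
rewrite (@detn_setrow_lin _ _ _ _ C (fun l k => nth (fun=> 0) (rcons S d) l k)) //.
(* That sequence is a combination of S and d. The terms with l < m repeat an element of S, and d has
   the coefficient [minor id S]. *)
rewrite big_ord_recr big1 => [|[l ll] _ /=]; last first.
  rewrite (@detn_eqrow _ _ m.+2 l) ?mulr0 //.
  - by rewrite ltnS ltnW // ltnW // ltnS ltnW.
  - by rewrite gtn_eqF // ltnS ltnW // ltnS ltnW.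
  - move=> j _; rewrite /setrow eqxx ltn_eqF; last by rewrite ltnS ltnW // ltnS ltnW.
    by rewrite /F nth_rcons nth_cat ll.
rewrite /= add0r nth_rcons ltnn eqxx; congr (_ * _).
  rewrite /C addnn -mul2n exprM sqrrN expr1n expr1n mul1r.
  by apply: eq_detn => u l lu ll; rewrite /bump leqNgt ll nth_rcons ll.
rewrite minor_swap -cat_rcons minor_swap opprK cat_rcons /minor size_cat addn3 -[RHS]detn_tr.
apply: eq_detn => i j _ _; rewrite /setrow; case: eqP => // ->.
by rewrite -addn2 N.
Qed.

(* Both sides are the trace of [adj f *m g]. *)
Lemma detn_trace n f (g : nat -> nat -> K) :
  \sum_(k < n) detn n (setrow k (g k) f)
  = \sum_(k < n) detn n (fun i j => if j == k then g i j else f i j).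
Proof.
pose A := \matrix_(i < n, j < n) f i j.
transitivity (\sum_(k < n) \sum_(j < n) g k j * cofactor A k j).
  apply: eq_bigr => k _; rewrite (detn_setrow _ (ltn_ord k)); apply: eq_bigr => j _.
  by congr (_ * cofactor _ _ _); apply: val_inj.
rewrite exchange_big; apply: eq_bigr => k _; rewrite -detn_tr.
transitivity (detn n (setrow k (fun j => g j k) (fun i j => f j i))); last first.
  by apply: eq_detn => i j _ _; rewrite /setrow; case: eqP => // ->.
rewrite (detn_setrow _ (ltn_ord k)); apply: eq_bigr => j _.
rewrite -cofactor_tr; congr (_ * cofactor _ _ _); last exact: val_inj.
by apply/matrixP => u v; rewrite !mxE.
Qed.

(** Both sides come from [detn_trace] applied to the entries [kap j * F i j]. Column by column, each
    column is scaled; row by row, the equation turns row k into a combination of the rows k+2, k+1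
    and k, and row k+1 is a repetition unless k = m. *)
Lemma minor_ode m cs (alpha beta gam : K) (s : nat -> K) (kap : nat -> K) :
    size cs = m.+1 ->
    (forall i j, (j < m.+1)%N -> let f := nth (fun=> 0) cs j in
      alpha * f i.+2 + (i%:R * beta + gam) * f i.+1 + s i * f i = kap j * f i) ->
  alpha * (\sum_(k < m.+1) minor (last1 k k.+2) cs)
    + (m%:R * beta + gam) * minor (last1 m m.+1) cs
    + (\sum_(k < m.+1) s k) * minor id cs
  = (\sum_(j < m.+1) kap j) * minor id cs.
Proof.
move=> szc ode; pose F i j := nth (fun=> 0) cs j i.
have E rho : minor rho cs = detn m.+1 (fun i j => F (rho i) j).
  by rewrite /minor szc.
have := detn_trace m.+1 F (fun i j => kap j * F i j).
have -> : \sum_(k < m.+1)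
    detn m.+1 (fun i j => if j == k then kap j * F i j else F i j)
    = (\sum_(j < m.+1) kap j) * minor id cs.
  rewrite mulr_suml; apply: eq_bigr => k _; rewrite E -[LHS]detn_tr -[in RHS]detn_tr.
  transitivity (detn m.+1 (setrow k (fun j => \sum_(l < 1) kap k * F j k)
     (fun i j => F j i))).
    by apply: eq_detn => i j _ _; rewrite /setrow big_ord1; case: eqP => // ->.
  rewrite (@detn_setrow_lin _ _ _ _ (fun=> kap k) (fun _ j => F j k)) // big_ord1.
  by congr (_ * _); apply: eq_detn => i j _ _; rewrite /setrow; case: eqP => // ->.
move=> <-.
have R (k : 'I_m.+1) : detn m.+1 (setrow k (fun j => kap j * F k j) F) =
   alpha * minor (last1 k k.+2) cs
   + (k%:R * beta + gam) * minor (last1 k k.+1) cs + s k * minor id cs.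
  pose c l := nth 0 [:: alpha; k%:R * beta + gam; s k] l.
  pose g l := nth (F 0) [:: F k.+2; F k.+1; F k] l.
  transitivity (detn m.+1 (setrow k (fun j => \sum_(l < 3) c l * g l j) F)).
    apply: eq_detn => i j _ lj; rewrite /setrow; case: eqP => // _.
    by rewrite !big_ord_recr big_ord0 /= add0r -ode.
  rewrite detn_setrow_lin // !big_ord_recr big_ord0 /= add0r !E.
  by congr (_ * _ + _ * _ + _ * _); apply: eq_detn => i j _ _;
    rewrite /setrow ?/last1; case: eqP => // ->.
under [RHS]eq_bigr => k _ do rewrite R.
rewrite !big_split /= -mulr_sumr -mulr_suml; congr (_ + _ + _).
rewrite big_ord_recr big1 /= ?add0r // => k _.
rewrite (@minor_eqrow _ _ k k.+1) ?mulr0 ?szc //.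
- exact: leqW.
- exact: (ltn_ord k).
- by rewrite neq_ltn ltnSn.
- by rewrite /last1 eqxx gtn_eqF.
Qed.

(** A determinant is differentiated row by row, and differentiating row [k] raises its order by
    one. *)
Definition incr rho k i := (rho i + (i == k))%N.

Lemma minor_incr_id m cs : size cs = m.+1 ->
  \sum_(k < m.+1) minor (incr id k) cs = minor (last1 m m.+1) cs.
Proof.
move=> szc; rewrite big_ord_recr big1 /= ?add0r // => [|k _].
  by apply: eq_minor => i _; rewrite /incr /last1; case: eqP => [->|_]; rewrite ?addn1 ?addn0.
rewrite (@minor_eqrow _ _ k k.+1) ?szc //.
- exact: leqW.
- exact: (ltn_ord k).
- by rewrite neq_ltn ltnSn.
- by rewrite /incr eqxx gtn_eqF // addn1 addn0.
Qed.

Lemma minor_incr_last m cs : size cs = m.+2 ->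
  \sum_(k < m.+2) minor (incr (last1 m.+1 m.+2) k) cs =
  minor (last1 m.+1 m.+3) cs + minor (last2 m m.+1 m.+2) cs.
Proof.
move=> szc; rewrite !big_ord_recr big1 /= ?add0r // => [|k _].
  rewrite addrC; congr (_ + _); apply: eq_minor => i _; rewrite /incr /last1 /last2.
  - by case: ifP; rewrite ?addn1 ?addn0.
  - by case: (i =P m) => [->|_]; rewrite ?(ltn_eqF (ltnSn m)) ?addn1 ?addn0.
have lk := ltn_ord k.
rewrite (@minor_eqrow _ _ k k.+1) ?szc //.
- exact: leqW (leqW _).
- exact: leqW.
- by rewrite neq_ltn ltnSn.
- by rewrite /incr /last1 eqxx (ltn_eqF (leqW lk)) eqSS (ltn_eqF lk) gtn_eqF // addn1 addn0.
Qed.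

(** Row k+2 is a repetition for k < m. For k = m the rows end in m+2, m+1, and exchanging these two
    gives the minus sign. *)
Lemma minor_shift2 m cs : size cs = m.+2 ->
  \sum_(k < m.+2) minor (last1 k k.+2) cs =
  minor (last1 m.+1 m.+3) cs - minor (last2 m m.+1 m.+2) cs.
Proof.
move=> szc; rewrite !big_ord_recr big1 /= ?add0r // => [|k _].
  rewrite addrC; congr (_ + _).
  have -> : minor (last1 m m.+2) cs = minor (fun l => last2 m m.+1 m.+2
      (if l == m then m.+1 else if l == m.+1 then m else l)) cs.
    apply: eq_minor => i _; rewrite /last1 /last2; case: (i =P m) => [_|ne].
      by rewrite gtn_eqF // eqxx.
    case: (i =P m.+1) => [->|]; first by rewrite eqxx.
    by move: ne => /eqP/negPf-> /eqP/negPf->.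
  rewrite /minor szc (@detn_swap _ (fun i j => nth (fun=> 0) cs j (last2 m m.+1 m.+2 i))) //.
  by rewrite neq_ltn ltnSn.
have lk := ltn_ord k.
rewrite (@minor_eqrow _ _ k k.+2) ?szc //.
- exact: leqW (leqW _).
- by rewrite neq_ltn leqW.
- by rewrite /last1 eqxx gtn_eqF // leqW.
Qed.

(* For nonempty lists of columns, Wronskians and their first two derivatives. *)
Definition wr cs := minor id cs.
Definition wr1 cs := minor (last1 (size cs).-1 (size cs)) cs.
Definition wr2 cs :=
  \sum_(k < size cs) minor (incr (last1 (size cs).-1 (size cs)) k) cs.

(** * Bilinear identities for two Wronskians with common columns *)

Section Bilinear.
Variables (alpha beta gam : K) (s : nat -> K).
(** The differential equation differentiated [i] times and read at a point: [alpha], [beta], [gam]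
    are the values of c2, c2', c1, and [s i] collects the contributions of c2'' and c1', which are
    constant. *)
Definition ode_jet (k : K) (f : nat -> K) := forall i,
  alpha * f i.+2 + (i%:R * beta + gam) * f i.+1 + s i * f i = k * f i.

Variables (S : seq (nat -> K)) (kS : nat -> K).
Hypothesis odeS : forall j, (j < size S)%N -> ode_jet (kS j) (nth (fun=> 0) S j).
Variables (d e c : nat -> K) (kd ke kc : K).
Hypotheses (oded : ode_jet kd d) (odee : ode_jet ke e) (odec : ode_jet kc c).

Let m := size S.
Let sumS := \sum_(j < m) kS j.
Let sig n := \sum_(k < n) s k.
(* [|0, ..., m-1, m+2| - |0, ..., m-2, m, m+1|] for a list of [m.+1] columns *)
Let G cs := \sum_(k < size cs) minor (last1 k k.+2) cs.

Lemma minor_ode1 a ka : ode_jet ka a ->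
  alpha * G (rcons S a) + (m%:R * beta + gam) * minor (last1 m m.+1) (rcons S a)
    + sig m.+1 * minor id (rcons S a) = (sumS + ka) * minor id (rcons S a).
Proof.
move=> odea; rewrite /G size_rcons.
rewrite (@minor_ode m _ alpha beta gam s (fun j => if (j < m)%N then kS j else ka)).
- rewrite big_ord_recr /= ltnn; congr ((_ + _) * _).
  by apply: eq_bigr => j _; rewrite ltn_ord.
- by rewrite size_rcons.
- move=> i j; rewrite ltnS leq_eqVlt nth_rcons => /orP[/eqP->|lj].
    by rewrite ltnn eqxx; apply: odea.
  by rewrite lj; apply: odeS.
Qed.

Lemma minor_ode2 a b ka kb : ode_jet ka a -> ode_jet kb b ->
  alpha * G (S ++ [:: a; b])
    + (m.+1%:R * beta + gam) * minor (last1 m.+1 m.+2) (S ++ [:: a; b])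
    + sig m.+2 * minor id (S ++ [:: a; b])
  = (sumS + ka + kb) * minor id (S ++ [:: a; b]).
Proof.
move=> odea odeb; rewrite /G size_cat addn2.
rewrite (@minor_ode m.+1 _ alpha beta gam s
  (fun j => if (j < m)%N then kS j else if j == m then ka else kb)).
- rewrite !big_ord_recr /= ltnn ltnNge leqnSn eqxx gtn_eqF //; congr ((_ + _ + _) * _).
  by apply: eq_bigr => j _; rewrite ltn_ord.
- by rewrite size_cat addn2.
- move=> i j lj; have [lj'|] := ltnP j m; first by rewrite nth_cat lj'; apply: odeS.
  rewrite leq_eqVlt => /orP[/eqP<-|mj].
    by rewrite eqxx nth_cat ltnn subnn; apply: odea.
  have -> : j = m.+1 by apply/eqP; rewrite eqn_leq mj -ltnS lj.
  by rewrite gtn_eqF // nth_cat ltnNge leqnSn subSnn; apply: odeb.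
Qed.

Let w a := minor id (rcons S a).
Let w1 a := minor (last1 m m.+1) (rcons S a).
Let w2 a := \sum_(k < m.+1) minor (incr (last1 m m.+1) k) (rcons S a).
Let v a b := minor id (S ++ [:: a; b]).
Let v1 a b := minor (last1 m.+1 m.+2) (S ++ [:: a; b]).
Let v2 a b := \sum_(k < m.+2) minor (incr (last1 m.+1 m.+2) k) (S ++ [:: a; b]).

(** With A and B the two determinants of the comment on [G], the second derivative is A + B and [G]
    is A - B. Here B is eliminated, and A in [second_derivative2], so as to keep the determinants
    that occur in [minor_laplace]. *)
Lemma second_derivative1 a :
  w2 a = 2 * minor (last1 m m.+2) (rcons S a) - G (rcons S a).
Proof.
rewrite /w2 /G size_rcons !big_ord_recr /=.
have -> : minor (incr (last1 m m.+1) m) (rcons S a) = minor (last1 m m.+2) (rcons S a).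
  by apply: eq_minor => i _; rewrite /incr /last1; case: ifP; rewrite ?addn1 ?addn0.
suff -> : \sum_(i < m) minor (incr (last1 m m.+1) i) (rcons S a) =
   - \sum_(i < m) minor (last1 i i.+2) (rcons S a) by ring.
rewrite -sumrN; case: (posnP m) => [->|m0]; first by rewrite !big_ord0.
have [p mE] : exists p, m = p.+1 by exists m.-1; rewrite prednK.
have sz : size (rcons S a) = p.+2 by rewrite size_rcons -/m mE.
have := minor_incr_last sz; have := minor_shift2 sz.
rewrite sumrN mE !(big_ord_recr p.+1) /=.
have -> : minor (incr (last1 p.+1 p.+2) p.+1) (rcons S a) =
    minor (last1 p.+1 p.+3) (rcons S a).
  by apply: eq_minor => i _; rewrite /incr /last1; case: ifP; rewrite ?addn1 ?addn0.
move=> /(canRL (addrK _)) -> /(canRL (addrK _)) ->; ring.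
Qed.

Lemma second_derivative2 a b :
  v2 a b = G (S ++ [:: a; b]) + 2 * minor (last2 m m.+1 m.+2) (S ++ [:: a; b]).
Proof.
have sz : size (S ++ [:: a; b]) = m.+2 by rewrite size_cat addn2.
by rewrite /v2 /G minor_incr_last // sz minor_shift2 //; ring.
Qed.

Let sigS : sig m.+2 = sig m.+1 + s m.+1.
Proof. exact: big_ord_recr. Qed.

Lemma plucker_w : w d * v e c - w e * v d c + w c * v d e = 0.
Proof. by apply: minor_plucker0 => i li; apply: leqW. Qed.

Lemma plucker_w1 : w1 d * v e c - w1 e * v d c + w1 c * v d e = 0.
Proof.
apply: minor_plucker0 => i li; rewrite /last1; case: eqP => // _; exact: leqW.
Qed.

(** Only the last term of [G] involves a row beyond m+1; it is given by [minor_plucker_top], and the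
    others cancel by [minor_plucker0]. *)
Lemma plucker_G : G (rcons S d) * v e c - G (rcons S e) * v d c + G (rcons S c) * v d e
  = minor id S * minor id (S ++ [:: d; e; c]).
Proof.
rewrite -minor_plucker_top /G !size_rcons !big_ord_recr /= -/m.
set r := fun x => \sum_(i < m) minor (last1 i i.+2) (rcons S x).
suff : r d * v e c - r e * v d c + r c * v d e = 0.
  by rewrite /r /v => H; apply/eqP; rewrite -subr_eq0 -[X in _ == X]H; apply/eqP; ring.
rewrite /r !mulr_suml -sumrB -big_split big1 //= => k _.
apply: minor_plucker0 => i li; rewrite /last1; case: eqP => // _; last exact: leqW.
by rewrite ltnS ltn_ord.
Qed.

(** The equations of (S, d), (S, e), (S, c) are combined with the weights of the Plücker relation.
    This isolates [G], cancels the first derivatives, and leaves the energies as the only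
    obstruction to cancelling the Wronskians. *)
Lemma minor_energy : alpha * (minor id S * minor id (S ++ [:: d; e; c]))
  = (kd - kc) * (w d * v e c) + (kc - ke) * (w e * v d c).
Proof.
(* Each relation is made an expression equal to zero, so that [ring] can check the target plus a
   combination of these expressions. *)
have lin (x y : K) : x = y -> x - y = 0 by move=> ->; rewrite subrr.
have Ed := lin _ _ (minor_ode1 oded); have Ee := lin _ _ (minor_ode1 odee).
have Ec := lin _ _ (minor_ode1 odec).
rewrite -/(w _) -/(w1 _) in Ed Ee Ec; rewrite -plucker_G.
have -> : alpha * (G (rcons S d) * v e c - G (rcons S e) * v d c + G (rcons S c) * v d e)
  = (kd - kc) * (w d * v e c) + (kc - ke) * (w e * v d c)
  + ((alpha * G (rcons S d) + (m%:R * beta + gam) * w1 d + sig m.+1 * w d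
       - (sumS + kd) * w d) * v e c
  - (alpha * G (rcons S e) + (m%:R * beta + gam) * w1 e + sig m.+1 * w e
       - (sumS + ke) * w e) * v d c
  + (alpha * G (rcons S c) + (m%:R * beta + gam) * w1 c + sig m.+1 * w c
       - (sumS + kc) * w c) * v d e
  - (m%:R * beta + gam) * (w1 d * v e c - w1 e * v d c + w1 c * v d e)
  + (sumS + kc - sig m.+1) * (w d * v e c - w e * v d c + w c * v d e)) by ring.
by rewrite Ed Ee Ec plucker_w plucker_w1; ring.
Qed.

(** Once second derivatives are expressed through [G], the terms in [G] are removed by [minor_ode1]
    and [minor_ode2]. The rest is twice [alpha] times the left-hand side of [minor_laplace], which
    [minor_energy] rewrites; this changes the sign pattern of the energies from ke + kc - kd to kd +
    ke - kc. *)
Lemma bilinear_replace_aux :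
  alpha * (w d * v2 e c - 2 * w1 d * v1 e c + w2 d * v e c)
  + (m.+1%:R * beta + gam) * w d * v1 e c - (m%:R * beta + gam) * w1 d * v e c
  = (kd + ke - kc - s m.+1) * (w d * v e c) + 2 * (kc - ke) * (w e * v d c).
Proof.
have lin (x y : K) : x = y -> x - y = 0 by move=> ->; rewrite subrr.
have Ed := lin _ _ (minor_ode1 oded); have Ev := lin _ _ (minor_ode2 odee odec).
rewrite -/(w _) -/(w1 _) -/(v _ _) -/(v1 _ _) in Ed Ev.
rewrite sigS in Ev.
have E := lin _ _ minor_energy; have L := lin _ _ (minor_laplace S d e c).
rewrite -/(w _) -/(w1 _) -/(v _ _) in L.
have e1 : minor (last2 m m m.+2) (S ++ [:: e; c]) = v1 e c.
  by apply: eq_minor => i _; rewrite /last1 /last2; case: (i =P m) => // ->; rewrite ltn_eqF.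
rewrite e1 in L; rewrite second_derivative1 second_derivative2.
set A := minor (last1 m m.+2) _ in L *; set B := minor (last2 m m.+1 m.+2) _ in L *.
have -> : alpha * (w d * (G (S ++ [:: e; c]) + 2 * B) - 2 * w1 d * v1 e c
      + (2 * A - G (rcons S d)) * v e c)
    + (m.+1%:R * beta + gam) * w d * v1 e c - (m%:R * beta + gam) * w1 d * v e c
  = (kd + ke - kc - s m.+1) * (w d * v e c) + 2 * (kc - ke) * (w e * v d c)
  + 2 * alpha * (w d * B - w1 d * v1 e c + A * v e c
       - minor id S * minor id (S ++ [:: d; e; c]))
  + 2 * (alpha * (minor id S * minor id (S ++ [:: d; e; c]))
      - ((kd - kc) * (w d * v e c) + (kc - ke) * (w e * v d c)))
  + w d * (alpha * G (S ++ [:: e; c]) + (m.+1%:R * beta + gam) * v1 e c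
      + (sig m.+1 + s m.+1) * v e c - (sumS + ke + kc) * v e c)
  - v e c * (alpha * G (rcons S d) + (m%:R * beta + gam) * w1 d
      + sig m.+1 * w d - (sumS + kd) * w d) by ring.
by rewrite Ed Ev E L; ring.
Qed.

(** The same elimination of [G], with the Laplace expansion taken along (S, c) against (S, d, e);
    its product of minors is now kept as the right-hand side. *)
Lemma bilinear_remove_aux :
  alpha * (v d e * w2 c - 2 * v1 d e * w1 c + v2 d e * w c)
  + (m.+1%:R * beta + gam) * v1 d e * w c - (m%:R * beta + gam) * v d e * w1 c
  = 2 * alpha * (minor id S * minor id (S ++ [:: d; e; c]))
    + (kd + ke - kc - s m.+1) * (v d e * w c).
Proof.
have lin (x y : K) : x = y -> x - y = 0 by move=> ->; rewrite subrr.
have Ec := lin _ _ (minor_ode1 odec); have Ev := lin _ _ (minor_ode2 oded odee).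
rewrite -/(w _) -/(w1 _) -/(v _ _) -/(v1 _ _) in Ec Ev.
rewrite sigS in Ev.
have L := lin _ _ (minor_laplace S c d e).
rewrite -/(w _) -/(w1 _) -/(v _ _) in L.
have e1 : minor (last2 m m m.+2) (S ++ [:: d; e]) = v1 d e.
  by apply: eq_minor => i _; rewrite /last1 /last2; case: (i =P m) => // ->; rewrite ltn_eqF.
have e2 : minor id (S ++ [:: c; d; e]) = minor id (S ++ [:: d; e; c]).
  by rewrite minor_swap -cat_rcons minor_swap opprK cat_rcons.
rewrite e1 e2 in L; rewrite second_derivative1 second_derivative2.
set A := minor (last1 m m.+2) _ in L *; set B := minor (last2 m m.+1 m.+2) _ in L *.
have -> : alpha * (v d e * (2 * A - G (rcons S c)) - 2 * v1 d e * w1 c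
      + (G (S ++ [:: d; e]) + 2 * B) * w c)
    + (m.+1%:R * beta + gam) * v1 d e * w c - (m%:R * beta + gam) * v d e * w1 c
  = 2 * alpha * (minor id S * minor id (S ++ [:: d; e; c]))
    + (kd + ke - kc - s m.+1) * (v d e * w c)
  + 2 * alpha * (w c * B - w1 c * v1 d e + A * v d e
       - minor id S * minor id (S ++ [:: d; e; c]))
  + w c * (alpha * G (S ++ [:: d; e]) + (m.+1%:R * beta + gam) * v1 d e
      + (sig m.+1 + s m.+1) * v d e - (sumS + kd + ke) * v d e)
  - v d e * (alpha * G (rcons S c) + (m%:R * beta + gam) * w1 c
      + sig m.+1 * w c - (sumS + kc) * w c) by ring.
by rewrite Ec Ev L; ring.
Qed.

Lemma bilinear_replace (W := rcons S d) (V := S ++ [:: e; c]) :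
  alpha * (wr W * wr2 V - 2 * wr1 W * wr1 V + wr2 W * wr V)
  + ((size S).+1%:R * beta + gam) * wr W * wr1 V
  - ((size S)%:R * beta + gam) * wr1 W * wr V
  = (kd + ke - kc - s (size S).+1) * (wr W * wr V)
    + 2 * (kc - ke) * (wr (rcons S e) * wr (S ++ [:: d; c])).
Proof.
have := bilinear_replace_aux.
by rewrite /wr1 /wr2 /W /V size_rcons size_cat addn2.
Qed.

Lemma bilinear_remove (V := S ++ [:: d; e]) (W := rcons S c) :
  alpha * (wr V * wr2 W - 2 * wr1 V * wr1 W + wr2 V * wr W)
  + ((size S).+1%:R * beta + gam) * wr1 V * wr W
  - ((size S)%:R * beta + gam) * wr V * wr1 W
  = 2 * alpha * (wr S * wr (S ++ [:: d; e; c]))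
    + (kd + ke - kc - s (size S).+1) * (wr V * wr W).
Proof.
have := bilinear_remove_aux.
by rewrite /wr1 /wr2 /W /V size_rcons size_cat addn2.
Qed.

End Bilinear.
End Det.

(** * Derivatives of determinants of functions *)

Section Derives.
Variables (R : realType) (c : params R).
Implicit Types (f g : R -> R) (x : R).

(** Only the domain counts, as the real powers are meaningful there. It is open, so functions that
    agree on it have the same derivatives there. *)
Definition derives f g := forall x, dom c x -> is_derive x 1 f (g x).

Lemma dom_near x : dom c x -> \forall y \near x, dom c y.
Proof.
case: c => [g|g h] /= dx; first exact: lt_nbhsr.
by near=> y; apply/andP; split; near: y;
  [apply: lt_nbhsr | apply: lt_nbhsl]; case/andP: dx.
Unshelve. all: by end_near. Qed.

Lemma eq_derives f1 f2 g1 g2 : (forall x, dom c x -> f1 x = f2 x) ->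
  (forall x, dom c x -> g1 x = g2 x) -> derives f1 g1 -> derives f2 g2.
Proof.
move=> ef eg d1 x dx; rewrite -eg //; apply: near_eq_is_derive (d1 x dx).
by apply: filterS (dom_near dx) => y dy; rewrite ef.
Qed.

Lemma derives_unique f1 f2 g1 g2 : (forall x, dom c x -> f1 x = f2 x) ->
  derives f1 g1 -> derives f2 g2 -> forall x, dom c x -> g1 x = g2 x.
Proof.
move=> ef d1 d2 x dx.
have := eq_derives ef (fun _ _ => erefl) d1 dx.
by move=> /@derive_val <-; have := d2 x dx => /@derive_val <-.
Qed.

Lemma derives_cst a : derives (fun=> a) (fun=> 0).
Proof. by move=> x _; exact: is_derive_cst. Qed.

Lemma derivesD f1 f2 g1 g2 : derives f1 g1 -> derives f2 g2 ->
  derives (fun x => f1 x + f2 x) (fun x => g1 x + g2 x).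
Proof. by move=> d1 d2 x dx; apply: is_deriveD; [exact: d1|exact: d2]. Qed.

Lemma derivesM f1 f2 g1 g2 : derives f1 g1 -> derives f2 g2 ->
  derives (fun x => f1 x * f2 x) (fun x => g1 x * f2 x + f1 x * g2 x).
Proof.
move=> d1 d2 x dx; apply: is_derive_eq.
  by apply: is_deriveM; [exact: d1|exact: d2].
by rewrite /GRing.scale /= addrC [f2 x * _]mulrC.
Qed.

Lemma derives_horner (p : {poly R}) : derives (horner p) (horner p^`()).
Proof. by move=> x _; exact: is_derive_poly. Qed.

Lemma derives_sum (I : Type) (r : seq I) (f g : I -> R -> R) :
  (forall i, derives (f i) (g i)) ->
  derives (fun x => \sum_(i <- r) f i x) (fun x => \sum_(i <- r) g i x).
Proof.
move=> d; elim: r => [|i r IH].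
  by apply: eq_derives (derives_cst 0) => x _; rewrite big_nil.
by apply: eq_derives (derivesD (d i) IH) => x _; rewrite big_cons.
Qed.

Lemma derives_prod (I : eqType) (r : seq I) (f g : I -> R -> R) : uniq r ->
  (forall i, derives (f i) (g i)) ->
  derives (fun x => \prod_(i <- r) f i x)
    (fun x => \sum_(k <- r) \prod_(i <- r) (if i == k then g i x else f i x)).
Proof.
move=> + d; elim: r => [_|i r IH /= /andP[ir ur]].
  by apply: eq_derives (derives_cst 1) => x _; rewrite !big_nil.
apply: eq_derives (derivesM (d i) (IH ur)) => x _; rewrite !big_cons //.
rewrite eqxx; congr (_ * _ + _).
  by apply: eq_big_seq => k kr; case: eqP kr ir => // -> ->.
rewrite mulr_sumr; apply: eq_big_seq => k kr; rewrite big_cons.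
by case: eqP kr ir => // -> ->.
Qed.

Lemma derives_detn n (f g : nat -> nat -> R -> R) :
  (forall i j, (j < n)%N -> derives (f i j) (g i j)) ->
  derives (fun x => detn n (fun i j => f i j x))
    (fun x => \sum_(k < n) detn n (fun i j => if i == k then g i j x else f i j x)).
Proof.
move=> d; apply: (@eq_derives (fun x => \sum_(s : 'S_n) (-1) ^+ s *
   \prod_(i <- index_enum 'I_n) f i (s i) x) _ (fun x => \sum_(s : 'S_n)
   (0 * \prod_(i <- index_enum 'I_n) f i (s i) x + (-1) ^+ s *
   \sum_(k < n) \prod_(i <- index_enum 'I_n)
     (if i == k then g i (s i) x else f i (s i) x)))).
- move=> x _; apply: eq_bigr => s _; congr (_ * _).
  by apply: eq_bigr => i _; rewrite mxE.
- move=> x _; under eq_bigr => s _ do rewrite mul0r add0r mulr_sumr.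
  rewrite [LHS]exchange_big /=; apply: eq_bigr => k _; apply: eq_bigr => s _.
  by congr (_ * _); apply: eq_bigr => i _; rewrite mxE.
- apply: derives_sum => s; apply: derivesM; first exact: derives_cst.
  apply: derives_prod; first exact: index_enum_uniq.
  by move=> i; apply: d.
Qed.

(** Functions are carried along with closed forms of all their derivatives; [derive1n_jet]
    identifies these with the iterated derivatives in [wronskian]. *)
Definition jet (F : nat -> R -> R) := forall i, derives (F i) (F i.+1).

Definition jet_at x (F : nat -> R -> R) : nat -> R := fun i => F i x.

Lemma derives_minor (cs : seq (nat -> R -> R)) rho :
  (forall j, (j < size cs)%N -> jet (nth (fun _ _ => 0) cs j)) ->
  derives (fun x => minor rho [seq jet_at x F | F <- cs])
    (fun x => \sum_(k < size cs) minor (incr rho k) [seq jet_at x F | F <- cs]).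
Proof.
move=> jcs; pose f (r : nat -> nat) i j x := nth (fun _ _ => 0) cs j (r i) x.
have E r x : minor r [seq jet_at x F | F <- cs] = detn (size cs) (fun i j => f r i j x).
  rewrite /minor size_map; apply: eq_detn => i j _ lj.
  by rewrite (nth_map (fun _ _ => 0)).
apply: eq_derives (@derives_detn (size cs) (f rho) (f (fun i => (rho i).+1)) _).
- by move=> x _; rewrite E.
- move=> x _; apply: eq_bigr => k _; rewrite E; apply: eq_detn => i j _ _.
  by rewrite /f /incr; case: eqP => _; rewrite ?addn1 ?addn0.
- by move=> i j lj; apply: jcs.
Qed.

Lemma derive1n_jet f (F : nat -> R -> R) : jet F ->
  (forall x, dom c x -> F 0 x = f x) ->
  forall i x, dom c x -> F i x = derive1n i f x.
Proof.
move=> jF F0; elim=> [|i IH] x dx; first by rewrite F0.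
rewrite derive1nS derive1E.
by have := eq_derives IH (fun _ _ => erefl) (jF i) dx => /@derive_val ->.
Qed.

(** Induction on the number of differentiations. As p2'' and p1' are constant, Leibniz' rule stops
    after the binomial coefficients 1, i, i(i-1)/2 for p2 and 1, i for p1. *)
Lemma ode_jet_at (F : nat -> R -> R) (p2 p1 : {poly R}) (t u k : R) :
  jet F -> p2^`()^`() = t%:P -> p1^`() = u%:P ->
  (forall x, dom c x -> p2.[x] * F 2 x + p1.[x] * F 1 x = k * F 0 x) ->
  forall x, dom c x ->
    ode_jet p2.[x] p2^`().[x] p1.[x]
      (fun i => (i%:R * (i%:R - 1) / 2) * t + i%:R * u) k (jet_at x F).
Proof.
move=> jF e2 e1 ode x dx i; rewrite /jet_at; elim: i x dx => [|i IH] x dx.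
  by rewrite -ode //; ring.
have dl : derives (fun x => p2.[x] * F i.+2 x + (i%:R * p2^`().[x] + p1.[x]) * F i.+1 x
    + (i%:R * (i%:R - 1) / 2 * t + i%:R * u) * F i x)
  (fun x => p2^`().[x] * F i.+2 x + p2.[x] * F i.+3 x +
    ((0 * p2^`().[x] + i%:R * p2^`()^`().[x] + p1^`().[x]) * F i.+1 x +
      (i%:R * p2^`().[x] + p1.[x]) * F i.+2 x)
    + (0 * F i x + (i%:R * (i%:R - 1) / 2 * t + i%:R * u) * F i.+1 x)).
  apply: derivesD; [apply: derivesD|]; apply: derivesM => //; try exact: derives_cst.
    exact: derives_horner.
  apply: derivesD; last exact: derives_horner.
  by apply: derivesM; [exact: derives_cst|exact: derives_horner].
have dr : derives (fun x => k * F i x) (fun x => 0 * F i x + k * F i.+1 x).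
  by apply: derivesM => //; exact: derives_cst.
have := derives_unique IH dl dr dx; rewrite e2 e1 !hornerC !mul0r !add0r => <-.
by rewrite -natr1; field.
Qed.

End Derives.

(** * The Laguerre and Jacobi differential equations *)

Section Classical.
Variable R : realType.
Implicit Types (a b x : R) (n : nat).

Lemma gbinomS a k : k.+1%:R * gbinom a k.+1 = (a - k%:R) * gbinom a k.
Proof.
rewrite /gbinom big_ord_recr /= factS natrM.
have k0 : k.+1%:R != 0 :> R by rewrite pnatr_eq0.
have f0 : (k`!)%:R != 0 :> R by rewrite pnatr_eq0 -lt0n fact_gt0.
by field; rewrite ?nat1r ?natr1 k0 f0.
Qed.

Lemma coef_laguerre a n k : (laguerre a n)`_k =
  if (k <= n)%N then (-1) ^+ k * gbinom (n%:R + a) (n - k) / (k`!)%:R else 0.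
Proof.
rewrite /laguerre -ltnS.
by rewrite -(poly_def n.+1 (fun k => (-1) ^+ k * gbinom (n%:R + a) (n - k) / (k`!)%:R)) coef_poly.
Qed.

(** The coefficients L_k satisfy (k+1)(k+a+1) L_(k+1) = (k-n) L_k, by [gbinomS]. *)
Lemma laguerre_ode a n :
  'X * (laguerre a n)^`()^`() + ((a + 1)%:P - 'X) * (laguerre a n)^`()
  = - n%:R *: laguerre a n.
Proof.
apply/polyP => k; rewrite mulrBl !coefD coefN !coefXM mul_polyC !coefZ !coef_deriv.
have -> : (if k == 0%N then 0 else (laguerre a n)`_k.-1.+2 *+ k.-1.+2 *+ k.-1.+1)
    = (laguerre a n)`_k.+1 *+ k.+1 *+ k.
  by case: k => //; rewrite mulr0n.
have -> : (if k == 0%N then 0 else (laguerre a n)`_k.-1.+1 *+ k.-1.+1)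
    = (laguerre a n)`_k *+ k.
  by case: k => //; rewrite mulr0n.
rewrite !coef_laguerre; case: (ltngtP k n) => [kn|kn|->].
- have := gbinomS (n%:R + a) (n - k.+1); rewrite subnSK // factS exprS natrM.
  have f0 : (k`!)%:R != 0 :> R by rewrite pnatr_eq0 -lt0n fact_gt0.
  have k0 : k.+1%:R != 0 :> R by rewrite pnatr_eq0.
  rewrite !natrB ?(ltnW kn) //.
  have -> : n%:R + a - (n%:R - k.+1%:R) = a + 1 + k%:R :> R by rewrite -natr1; ring.
  move: (gbinom _ (n - k)) (gbinom _ (n - k.+1)) ((-1) ^+ k) => G G' sg e.
  transitivity (- (sg / (k`!)%:R) * ((a + 1 + k%:R) * G' + k%:R * G)).
    by field; rewrite ?nat1r ?natr1 k0 f0.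
  by rewrite -e; field.
- by rewrite !mul0rn; ring.
- by rewrite !mul0rn; ring.
Qed.

(** The factor p avoids the exponents k-1 and k-2, so that k = 0 and k = 1 are not exceptions. *)
Lemma horner_deriv_exp_affine (p : {poly R}) r k x : p^`() = r%:P ->
  let A := p ^+ k in
  p.[x] * A^`().[x] = r * k%:R * A.[x] /\
  p.[x] * A^`()^`().[x] = r * (k%:R - 1) * A^`().[x].
Proof.
move=> pr /=; have E j : (p ^+ j)^`().[x] = r * j%:R * (p ^+ j.-1).[x].
  by rewrite deriv_exp pr hornerMn hornerM hornerC -mulr_natr; ring.
split; rewrite !deriv_exp ?E.
  case: k => [|k]; first by rewrite !mulr0n hornerC; ring.
  by rewrite pr hornerMn hornerM hornerC exprS hornerM -mulr_natr /=; ring.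
rewrite pr derivMn derivM derivC mul0r add0r !hornerMn !hornerM !hornerC E.
case: k => [|[|k]]; [by rewrite !mulr0n; ring|by rewrite /= !mulr1n; ring|].
by rewrite exprS hornerM /=; ring.
Qed.

(** With u = (x-1)/2 and v = (x+1)/2, the operator sends T_s = u^s v^(n-s) to a combination of
    T_(s-1), T_s and T_(s+1); the recursion [CS] for the coefficients cancels the contributions of
    neighbouring indices. *)
Lemma jacobi_ode a b n x :
  (1 - x ^+ 2) * (jacobi a b n)^`()^`().[x]
    + (b - a - (a + b + 2) * x) * (jacobi a b n)^`().[x]
  = - (n%:R * (n%:R + a + b + 1)) * (jacobi a b n).[x].
Proof.
pose u : {poly R} := 2^-1 *: ('X - 1); pose v : {poly R} := 2^-1 *: ('X + 1).
have du : u^`() = (2^-1)%:P.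
  by rewrite derivZ derivB derivX derivC subr0 -mul_polyC mulr1.
have dv : v^`() = (2^-1)%:P.
  by rewrite derivZ derivD derivX derivC addr0 -mul_polyC mulr1.
have ux : u.[x] = (x - 1) / 2 by rewrite /u hornerZ hornerD hornerX -polyCN hornerC mulrC.
have vx : v.[x] = (x + 1) / 2 by rewrite /v hornerZ hornerD hornerX hornerC mulrC.
pose C s := gbinom (n%:R + a) (n - s) * gbinom (n%:R + b) s.
pose T s := u ^+ s * v ^+ (n - s).
have jE : jacobi a b n = \sum_(s < n.+1) C s *: T s by [].
have CS s : (s < n)%N ->
    C s.+1 * ((s%:R + 1 + a) * (s%:R + 1)) = C s * ((n%:R - s%:R + b) * (n%:R - s%:R)).
  move=> sn; have := gbinomS (n%:R + a) (n - s.+1); have := gbinomS (n%:R + b) s.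
  rewrite subnSK // !natrB ?(ltnW sn) // -natr1 /C => e1 e2.
  transitivity (((s%:R + 1) * gbinom (n%:R + b) s.+1) *
     ((n%:R + a - (n%:R - (s%:R + 1))) * gbinom (n%:R + a) (n - s.+1))); first by ring.
  by rewrite e1 -e2; ring.
(* [D s] is s T_(s-1) and [E s] is (n-s) T_(s+1), in a form that makes sense, and vanishes, for s =
   0 and s = n respectively. *)
pose D s := 2 * v.[x] * (u ^+ s)^`().[x] * (v ^+ (n - s)).[x].
pose E s := 2 * u.[x] * (u ^+ s).[x] * (v ^+ (n - s))^`().[x].
have op s : (s <= n)%N ->
  (1 - x ^+ 2) * (T s)^`()^`().[x] + (b - a - (a + b + 2) * x) * (T s)^`().[x]
  + n%:R * (n%:R + a + b + 1) * (T s).[x]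
  = (s%:R + a) * (s%:R * (T s).[x] - D s)
    + (n%:R - s%:R + b) * ((n%:R - s%:R) * (T s).[x] - E s).
  move=> sn; have [A1 A2] := horner_deriv_exp_affine s x du.
  have [B1 B2] := horner_deriv_exp_affine (n - s) x dv; rewrite natrB // in B1 B2.
  rewrite /D /E /T !derivM derivD !derivM !hornerD !hornerM.
  have -> : 1 - x ^+ 2 = - 4 * u.[x] * v.[x].
    by rewrite ux vx; field.
  have -> : b - a - (a + b + 2) * x = - 2 * (b + 1) * u.[x] - 2 * (a + 1) * v.[x].
    by rewrite ux vx; field.
  move: (u ^+ s).[x] (v ^+ (n - s)).[x] (u ^+ s)^`().[x] (v ^+ (n - s))^`().[x]
    (u ^+ s)^`()^`().[x] (v ^+ (n - s))^`()^`().[x] u.[x] v.[x] A1 A2 B1 B2.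
  move=> A B A' B' A'' B'' U V A1 A2 B1 B2.
  transitivity (- 4 * (V * B * (U * A'') + U * A * (V * B''))
     - 8 * (U * A') * (V * B')
     - 2 * (b + 1) * (B * (U * A') + U * A * B') - 2 * (a + 1) * (V * A' * B + A * (V * B'))
     + n%:R * (n%:R + a + b + 1) * (A * B)); first by ring.
  by rewrite A1 A2 B1 B2; field.
have D0 : D 0 = 0 by rewrite /D expr0 derivC hornerC; ring.
have En : E n = 0 by rewrite /E subnn expr0 derivC hornerC; ring.
have DS s : (s < n)%N -> D s.+1 = (s%:R + 1) * (T s).[x].
  move=> sn; rewrite /D /T deriv_exp du /= hornerMn !hornerM hornerC.
  by rewrite -[(n - s)%N]subnSK // exprS hornerM -[(_ * _) *+ _]mulr_natr -natr1; field.
have ES s : (s < n)%N -> E s = (n%:R - s%:R) * (T s.+1).[x].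
  move=> sn; rewrite /E /T -subnSK // deriv_exp dv /= hornerMn !hornerM hornerC.
  by rewrite exprS hornerM -[(_ * _) *+ _]mulr_natr subnSK // natrB ?(ltnW sn) //; field.
apply/eqP; rewrite -subr_eq0 mulNr opprK; apply/eqP.
rewrite jE !raddf_sum /= !horner_sum !mulr_sumr -!big_split /=.
transitivity (\sum_(s < n.+1) C s * ((s%:R + a) * (s%:R * (T s).[x] - D s))
  + \sum_(s < n.+1) C s * ((n%:R - s%:R + b) * ((n%:R - s%:R) * (T s).[x] - E s))).
  rewrite -big_split /=; apply: eq_bigr => s _; rewrite -mulrDr -op; last by rewrite -ltnS.
  by rewrite !derivZ !hornerZ; ring.
(* The first term of the first sum and the last one of the second vanish; term s+1 of the first is
   then paired with term s of the second. *)
rewrite big_ord_recl D0 [X in _ + X]big_ord_recr /= En subrr mulr0n.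
rewrite [X in X + _]addrC addrACA -big_split big1 => [|s _] /=; first by ring.
rewrite /bump add1n DS // ES //.
transitivity (C s.+1 * ((s%:R + 1 + a) * (s%:R + 1)) * ((T s.+1).[x] - (T s).[x])
  + C s * ((n%:R - s%:R + b) * (n%:R - s%:R)) * ((T s).[x] - (T s.+1).[x])).
  by rewrite -natr1; ring.
by rewrite CS //; ring.
Qed.

End Classical.

(** * Seed functions and their derivatives *)

Section Waves.
Variables (R : realType) (c : params R).
Implicit Types (p l : {poly R}) (b la x : R).

(** The polynomial factor left in the i-th derivative of [l ^ b * p] after [l ^ (b - i)] is taken
    out, for [l] affine of slope [la]; [exp_poly] plays this role for the product of the exponential
    and [p]. *)
Fixpoint pow_poly l la b p i : {poly R} :=
  if i is j.+1 then
    ((b - j%:R) * la) *: pow_poly l la b p j + l * (pow_poly l la b p j)^`()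
  else p.

Fixpoint exp_poly p i : {poly R} :=
  if i is j.+1 then exp_poly p j + (exp_poly p j)^`() else p.

Definition pow_jet l la b p : nat -> R -> R :=
  fun i x => l.[x] `^ (b - i%:R) * (pow_poly l la b p i).[x].

Definition exp_jet p : nat -> R -> R := fun i x => expR x * (exp_poly p i).[x].

Lemma powRS b x : 0 < x -> x `^ b = x `^ (b - 1) * x.
Proof.
move=> x0; rewrite -[in X in _ * X](powRr1 (ltW x0)) -powRD ?subrK //.
by rewrite (gt_eqF x0) implybT.
Qed.

Lemma derives_powR l la b : l^`() = la%:P -> (forall x, dom c x -> 0 < l.[x]) ->
  derives c (fun x => l.[x] `^ b) (fun x => b * la * l.[x] `^ (b - 1)).
Proof.
move=> dl l0 x dx.
have dp := is_derive1_powR b (l0 x dx); have dh := is_derive_poly l x.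
apply: is_derive_eq; first exact: is_derive1_comp.
by rewrite dl hornerC; ring.
Qed.

Lemma pow_jet_jet l la b p : l^`() = la%:P -> (forall x, dom c x -> 0 < l.[x]) ->
  jet c (pow_jet l la b p).
Proof.
move=> dl l0 i.
apply: eq_derives (derivesM (derives_powR (b - i%:R) dl l0)
  (@derives_horner _ c (pow_poly l la b p i))) => // x dx.
rewrite /pow_jet /= hornerD hornerZ hornerM (powRS (b - i%:R)) ?l0 //.
have -> : b - i%:R - 1 = b - i.+1%:R by rewrite -natr1; ring.
by ring.
Qed.

Lemma exp_jet_jet p : jet c (exp_jet p).
Proof.
move=> i.
have de : derives c (@expR R) (@expR R) by move=> x _; exact: is_derive_expR.
apply: eq_derives (derivesM de (@derives_horner _ c (exp_poly p i))) => // x dx.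
by rewrite /exp_jet /= hornerD; ring.
Qed.

Lemma poly_jet p : jet c (fun i => horner p^`(i)).
Proof. by move=> i; rewrite derivnS; exact: derives_horner. Qed.

End Waves.

(** Seed functions and eigenpolynomials are treated uniformly as columns, since all satisfy
    [wave_ode]. *)
Inductive wave := WI of nat | WII of nat | WP of nat.

Definition wave_fun (R : realType) (c : params R) (w : wave) : R -> R :=
  match w with
  | WI v => muI c v
  | WII v => muII c v
  | WP n => horner (eigenP c n)
  end.

Definition wave_energy (R : realType) (c : params R) (w : wave) : R :=
  match w with
  | WI v => energyI c v
  | WII v => energyII c v
  | WP n => energy c n
  end.

Definition wave_jet (R : realType) (c : params R) (w : wave) : nat -> R -> R :=
  match c, w with
  | Laguerre g, WI v => exp_jet (laguerre (g - 1 / 2) v \Po - 'X)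
  | Laguerre g, WII v => pow_jet 'X 1 (1 / 2 - g) (laguerre (1 / 2 - g) v)
  | Jacobi g h, WI v =>
      pow_jet (2^-1 *: (1 + 'X)) 2^-1 (1 / 2 - h) (jacobi (g - 1 / 2) (1 / 2 - h) v)
  | Jacobi g h, WII v =>
      pow_jet (2^-1 *: (1 - 'X)) (- 2^-1) (1 / 2 - g) (jacobi (1 / 2 - g) (h - 1 / 2) v)
  | _, WP n => fun i => horner (eigenP c n)^`(i)
  end.

Section WaveLemmas.
Variables (R : realType) (c : params R).
Implicit Types (w : wave) (x : R).

Lemma horner_half1D x : (2^-1 *: (1 + 'X)).[x] = (1 + x) / 2 :> R.
Proof. by rewrite hornerZ hornerD hornerX hornerC mulrC. Qed.

Lemma horner_half1B x : (2^-1 *: (1 - 'X)).[x] = (1 - x) / 2 :> R.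
Proof. by rewrite hornerZ hornerD hornerN hornerX hornerC mulrC. Qed.

Lemma deriv_half1D : (2^-1 *: (1 + 'X))^`() = (2^-1)%:P :> {poly R}.
Proof. by rewrite derivZ derivD derivX derivC add0r -mul_polyC mulr1. Qed.

Lemma deriv_half1B : (2^-1 *: (1 - 'X))^`() = (- 2^-1)%:P :> {poly R}.
Proof. by rewrite derivZ derivB derivX derivC sub0r -mul_polyC mulrN1 polyCN. Qed.

Lemma wave_jet_jet w : jet c (wave_jet c w).
Proof.
case: c w => [g|g h] [v|v|v] /=; try exact: poly_jet.
- exact: exp_jet_jet.
- by apply: pow_jet_jet => [|x /=]; rewrite ?derivX ?hornerX.
- apply: pow_jet_jet => [|x /= /andP[x1 x2]]; first exact: deriv_half1D.
  by rewrite horner_half1D; lra.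
- apply: pow_jet_jet => [|x /= /andP[x1 x2]]; first exact: deriv_half1B.
  by rewrite horner_half1B; lra.
Qed.

Lemma wave_jet0 w x : wave_jet c w 0 x = wave_fun c w x.
Proof.
case: c w => [g|g h] [v|v|v] //=; rewrite /exp_jet /pow_jet ?subr0 //=.
- by rewrite horner_comp hornerN hornerX.
- by rewrite hornerX.
- by rewrite horner_half1D.
- by rewrite horner_half1B.
Qed.

Lemma pow_jet_ode (l p p2 p1 : {poly R}) la b k x : l^`() = la%:P -> 0 < l.[x] ->
    p2.[x] * ((b - 1) * la * (b * la * p.[x] + l.[x] * p^`().[x])
      + l.[x] * ((b + 1) * la * p^`().[x] + l.[x] * p^`()^`().[x]))
    + p1.[x] * l.[x] * (b * la * p.[x] + l.[x] * p^`().[x])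
    = k * l.[x] ^+ 2 * p.[x] ->
  p2.[x] * pow_jet l la b p 2 x + p1.[x] * pow_jet l la b p 1 x
  = k * pow_jet l la b p 0 x.
Proof.
move=> dl l0 e; rewrite /pow_jet /= !subr0.
rewrite !(hornerD, hornerZ, hornerM, derivD, derivZ, derivM) dl.
rewrite hornerC (powRS b) // (powRS (b - 1)) //.
have -> : b - 1 - 1 = b - 2 by ring.
transitivity (l.[x] `^ (b - 2) * (k * l.[x] ^+ 2 * p.[x])); last by ring.
by rewrite -e; ring.
Qed.

(** Changing the sign of g - 1/2 or of h - 1/2, or of x in the Laguerre case of type I, preserves
    the equation up to the factor in front of the seed polynomial and a constant; the constant makes
    up the difference of energies. *)
Lemma wave_ode w x : dom c x ->
  (c2 c).[x] * wave_jet c w 2 x + (c1 c).[x] * wave_jet c w 1 x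
  = - (wave_energy c w / 4) * wave_jet c w 0 x.
Proof.
have lag (a : R) n (y : R) : y * (laguerre a n)^`()^`().[y] + (a + 1 - y) * (laguerre a n)^`().[y]
    = - n%:R * (laguerre a n).[y].
  have /(congr1 (horner^~ y)) := laguerre_ode a n.
  by rewrite hornerD hornerZ !hornerM hornerX hornerD hornerN hornerX hornerC.
have c2J : (1 - 'X^2 : {poly R}).[x] = 1 - x ^+ 2.
  by rewrite hornerD hornerN hornerXn hornerC.
have c1J g h : ((h - g)%:P - (g + h + 1) *: 'X).[x] = h - g - (g + h + 1) * x.
  by rewrite hornerD hornerN hornerZ hornerX hornerC.
have c1L g : ((g + 1 / 2)%:P - 'X).[x] = g + 1 / 2 - x.
  by rewrite hornerD hornerN hornerX hornerC.
case: c w => [g|g h] [v|v|n] //= dx.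
- rewrite hornerX c1L /exp_jet /=; set p := laguerre _ _.
  rewrite !(derivD, deriv_comp, derivN, derivX, derivM) !(hornerD, hornerM, hornerN, derivC).
  rewrite !horner_comp !(hornerC, hornerN, hornerX).
  have := lag (g - 1 / 2) v (- x); rewrite -/p => e.
  transitivity (expR x * (- (- x * p^`()^`().[- x] + (g - 1 / 2 + 1 - - x) * p^`().[- x])
    + (g + 1 / 2) * p.[- x])); first by field.
  by rewrite e; field.
- apply: pow_jet_ode; rewrite ?derivX ?hornerX // c1L.
  set p := laguerre _ _; have := lag (1 / 2 - g) v x; rewrite -/p => e.
  transitivity (x ^+ 2 * (x * p^`()^`().[x] + (1 / 2 - g + 1 - x) * p^`().[x])
    - x ^+ 2 * (1 / 2 - g) * p.[x]); first by field.
  by rewrite e; field.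
- rewrite hornerX c1L; set p := laguerre _ _.
  have := lag (g - 1 / 2) n x; rewrite -/p => e.
  transitivity (x * p^`()^`().[x] + (g - 1 / 2 + 1 - x) * p^`().[x]); first by field.
  by rewrite e; field.
- apply: pow_jet_ode => //; first exact: deriv_half1D.
    by rewrite horner_half1D; case/andP: dx => *; lra.
  rewrite c1J c2J horner_half1D; set p := jacobi _ _ _.
  have := jacobi_ode (g - 1 / 2) (1 / 2 - h) v x; rewrite -/p => e.
  transitivity (((1 + x) / 2) ^+ 2 * ((1 - x ^+ 2) * p^`()^`().[x]
    + (1 / 2 - h - (g - 1 / 2) - (g - 1 / 2 + (1 / 2 - h) + 2) * x) * p^`().[x])
    + ((1 + x) / 2) ^+ 2 * (h - 1 / 2) * (g + 1 / 2) * p.[x]); first by field.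
  by rewrite e; field.
- apply: pow_jet_ode => //; first exact: deriv_half1B.
    by rewrite horner_half1B; case/andP: dx => *; lra.
  rewrite c1J c2J horner_half1B; set p := jacobi _ _ _.
  have := jacobi_ode (1 / 2 - g) (h - 1 / 2) v x; rewrite -/p => e.
  transitivity (((1 - x) / 2) ^+ 2 * ((1 - x ^+ 2) * p^`()^`().[x]
    + (h - 1 / 2 - (1 / 2 - g) - (1 / 2 - g + (h - 1 / 2) + 2) * x) * p^`().[x])
    + ((1 - x) / 2) ^+ 2 * (g - 1 / 2) * (h + 1 / 2) * p.[x]); first by field.
  by rewrite e; field.
- rewrite c1J c2J; set p := jacobi _ _ _.
  have := jacobi_ode (g - 1 / 2) (h - 1 / 2) n x; rewrite -/p => e.
  transitivity ((1 - x ^+ 2) * p^`()^`().[x]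
    + (h - 1 / 2 - (g - 1 / 2) - (g - 1 / 2 + (h - 1 / 2) + 2) * x) * p^`().[x]).
    by field.
  by rewrite e; field.
Qed.
End WaveLemmas.

(** * Powers dividing a determinant *)

(** Among n + 1 distinct natural numbers one is at least n, by the pigeonhole principle; it is
    removed and the induction continues. *)
Lemma uniq_sumn (s : seq nat) : uniq s -> ('C(size s, 2) <= sumn s)%N.
Proof.
move: {2}(size s) (erefl (size s)) => n; elim: n s => [|n IH] s sn us.
  by rewrite sn.
have [x xs nx] : exists2 x, x \in s & (n <= x)%N.
  apply/hasP; apply: contraT => /hasPn small.
  have := uniq_leq_size us (s2 := iota 0 n); rewrite size_iota sn ltnn => -> //.
  by move=> x xs; rewrite mem_iota /= add0n ltnNge small.
rewrite sn binS bin1 (perm_sumn (perm_to_rem xs)) /= addnC leq_add //.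
have sr : size (rem x s) = n by rewrite size_rem // sn.
by rewrite -{1}sr IH // rem_uniq.
Qed.

Lemma leq_bin2_sum (T : finType) (P : pred T) (f : T -> nat) :
  {in P &, injective f} -> ('C(#|P|, 2) <= \sum_(j | P j) f j)%N.
Proof.
move=> fi; have := @uniq_sumn [seq f j | j <- enum P].
rewrite size_map -cardE sumnE big_map big_enum /=; apply.
by rewrite map_inj_in_uniq ?enum_uniq // => x y; rewrite !mem_enum; exact: fi.
Qed.

Section Divisibility.
Variable K : comPzRingType.

Lemma detn_sum n (B : nat -> nat -> nat -> K) :
  detn n (fun i j => \sum_(l < n) B i l j) =
  \sum_(f : {ffun 'I_n -> 'I_n}) \det (\matrix_(i, j) B i (f j) j).
Proof.
rewrite -detn_tr.
transitivity (\sum_(s : 'S_n) \sum_(f : {ffun 'I_n -> 'I_n})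
    (-1) ^+ s * \prod_j B (s j) (f j) j).
  apply: eq_bigr => s _; rewrite -mulr_sumr; congr (_ * _).
  rewrite -(bigA_distr_bigA (fun (j l : 'I_n) => B (s j) l j)); apply: eq_bigr => j _.
  by rewrite mxE.
rewrite exchange_big; apply: eq_bigr => f _; rewrite -det_tr.
by apply: eq_bigr => s _; congr (_ * _); apply: eq_bigr => j _; rewrite !mxE.
Qed.

(* In the multilinear expansion of the determinant, the columns of a given
   type must pick distinct powers of z, or two columns are proportional. *)
Lemma detn_pow_dvd n (ty : nat -> bool) (z : K) (A : bool -> nat -> nat -> K)
    (sg : nat -> nat -> K) (M : nat -> nat -> K) :
    (forall i j, (i < n)%N -> (j < n)%N ->
      M i j = \sum_(l < n) A (ty j) i l * z ^+ l * sg l j) ->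
  exists Q, detn n M =
    z ^+ ('C(count ty (iota 0 n), 2) + 'C(count (predC ty) (iota 0 n), 2)) * Q.
Proof.
move=> ME; rewrite (eq_detn ME); set N := (_ + _)%N.
rewrite (detn_sum n (fun i l j => A (ty j) i l * z ^+ l * sg l j)).
elim/big_ind: _ => [|x y [Q1 ->] [Q2 ->]|f _].
- by exists 0; rewrite mulr0.
- by exists (Q1 + Q2); rewrite mulrDr.
pose D := \matrix_(i < n, j < n) A (ty j) i (f j).
have -> : \det (\matrix_(i < n, j < n) (A (ty j) i (f j) * z ^+ f j * sg (f j) j)) =
    z ^+ (\sum_j f j) * (\det D * \prod_j sg (f j) j).
  have -> : (\matrix_(i < n, j < n) (A (ty j) i (f j) * z ^+ f j * sg (f j) j)) =
      D *m diag_mx (\row_j (z ^+ f j * sg (f j) j)).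
    by apply/matrixP => i j; rewrite mul_mx_diag !mxE mulrA.
  rewrite det_mulmx det_diag; under eq_bigr do rewrite mxE.
  by rewrite big_split /= -expr_sum; ring.
have [/existsP[j /existsP[k /and3P[jk /eqP tjk /eqP fjk]]]|noteq] :=
  boolP [exists j : 'I_n, exists k : 'I_n, [&& j != k, ty j == ty k & f j == f k]].
  have -> : \det D = 0.
    by rewrite -det_tr; apply: (determinant_alternate jk) => i; rewrite !mxE tjk fjk.
  by exists 0; rewrite mul0r !mulr0.
have inj b : {in [pred j : 'I_n | ty j == b] &, injective (fun j => f j : nat)}.
  move=> j k /= /eqP tj /eqP tk /val_inj fjk; apply/eqP; apply: contraR noteq => jk.
  by apply/existsP; exists j; apply/existsP; exists k; rewrite jk tj tk fjk !eqxx.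
suff /subnKC <- : (N <= \sum_j f j)%N by rewrite exprD -mulrA; eexists.
have cnt (P : pred nat) : count P (iota 0 n) = #|[pred j : 'I_n | P j]|.
  by rewrite -val_enum_ord count_map cardE size_filter -enumT; apply: eq_count.
rewrite (bigID (fun j : 'I_n => ty j)) /= /N !cnt leq_add //.
  rewrite (eq_card (B := [pred j : 'I_n | ty j == true])) => [|j]; last by rewrite !inE eqb_id.
  apply: leq_trans (leq_bin2_sum (inj true)) _.
  by rewrite leq_eqVlt; apply/orP; left; apply/eqP/eq_bigl => j; rewrite /= eqb_id.
rewrite (eq_card (B := [pred j : 'I_n | ty j == false])) => [|j]; last by rewrite !inE eqbF_neg.
apply: leq_trans (leq_bin2_sum (inj false)) _.
by rewrite leq_eqVlt; apply/orP; left; apply/eqP/eq_bigl => j; rewrite /= eqbF_neg.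
Qed.

Lemma detn_scale n (r w : nat -> K) f :
  detn n (fun i j => r i * f i j * w j) =
  (\prod_(i < n) r i) * (\prod_(j < n) w j) * detn n f.
Proof.
have -> : detn n (fun i j => r i * f i j * w j) = \det (diag_mx (\row_(i < n) r i) *m
   (\matrix_(i < n, j < n) f i j) *m diag_mx (\row_(j < n) w j)).
  by congr (\det _); apply/matrixP => i j; rewrite mul_mx_diag mul_diag_mx !mxE.
rewrite !det_mulmx !det_diag /detn.
by under eq_bigr do rewrite mxE; under [X in _ * X]eq_bigr do rewrite mxE; ring.
Qed.

End Divisibility.

(** * Polynomiality *)

Lemma bin2D a b : 'C(a + b, 2) = ('C(a, 2) + 'C(b, 2) + a * b)%N.
Proof.
elim: b => [|b IH]; first by rewrite muln0 !addn0.
rewrite addnS !binS !bin1 IH; lia.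
Qed.

Section PowCoef.
Variable R : realType.
Implicit Types (l p : {poly R}) (la b x : R).

Fixpoint pow_coef la b i m : R :=
  if i is i'.+1 then
    (b - i'%:R + m%:R) * la * pow_coef la b i' m
    + (if m is m'.+1 then pow_coef la b i' m' else 0)
  else (m == 0%N)%:R.

Lemma pow_coef0 la b i m : (i < m)%N -> pow_coef la b i m = 0.
Proof.
elim: i m => [|i IH] [|m] //= im.
by rewrite !IH // ?mulr0 ?addr0 // ltnW.
Qed.

(** The coefficients depend on i and m but not on p, as [detn_pow_dvd] requires of columns of the
    same type; the bound n is free, so that all rows of a matrix can use the same number of
    terms. *)
Lemma pow_polyE l la b p i n : l^`() = la%:P -> (i < n)%N ->
  pow_poly l la b p i = \sum_(m < n) (pow_coef la b i m)%:P * l ^+ m * p^`(m).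
Proof.
move=> dl; elim: i => [|i IH] lin.
  case: n lin => // n _; rewrite big_ord_recl big1 => [|m _].
    by rewrite /= expr0 !mulr1 mul1r addr0.
  by rewrite /= mul0r mul0r.
case: n IH lin => // n IH lin; rewrite /= IH; last exact: ltnW.
set T := pow_coef la b i; set F := fun m => (T m)%:P * l ^+ m * p^`(m).
(* Differentiation shifts the index by one, and the term pushed out of the range has this
   coefficient. *)
have Tn : T n = 0 by apply: pow_coef0.
have dF m : l * (F m)^`() = (m%:R * la)%:P * F m + (T m)%:P * l ^+ m.+1 * p^`(m.+1).
  rewrite /F !derivM derivC mul0r add0r deriv_exp dl derivnS polyCM exprS.
  case: m => [|m]; first by rewrite !mulr0n; ring.
  by rewrite /= polyC_natr exprS; ring.
rewrite [(\sum_(m < n.+1) _)^`()]raddf_sum mulr_sumr scaler_sumr -big_split /=.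
under eq_bigr do rewrite dF addrA -mul_polyC -mulrDl -polyCD.
rewrite big_split /= [X in _ + X]big_ord_recr /= Tn mul0r mul0r addr0.
transitivity (\sum_(m < n.+1) ((b - i%:R + m%:R) * la)%:P * F m
   + \sum_(m < n.+1) (if m : nat is m'.+1 then T m' else 0)%:P * l ^+ m * p^`(m)).
  congr (_ + _); first by apply: eq_bigr => m _; congr (_%:P * _); ring.
  by rewrite big_ord_recl /= polyC0 !mul0r add0r.
rewrite -big_split; apply: eq_bigr => m _ /=.
by rewrite /F polyCD !polyCM; ring.
Qed.

Lemma powR_natB b x n q : 0 < x -> x `^ (n%:R - b * q%:R) = x ^+ n / (x `^ b) ^+ q.
Proof.
by move=> x0; rewrite powRD ?(gt_eqF x0) ?implybT // powRN powRrM !powR_mulrn ?powR_ge0 // ltW.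
Qed.

Lemma horner_detn n (f : nat -> nat -> {poly R}) x :
  (detn n f).[x] = detn n (fun i j => (f i j).[x]).
Proof.
rewrite /detn -[LHS]/(horner_eval x _) -det_map_mx.
by congr (\det _); apply/matrixP => i j; rewrite !mxE.
Qed.

End PowCoef.

Definition is_I w := if w is WI _ then true else false.
Definition is_II w := if w is WII _ then true else false.

Section Polynomiality.
Variables (R : realType) (c : params R).
Implicit Types (w : wave) (ws : seq wave) (x : R).

(** What remains of the i-th derivative once the weight is removed and row i is multiplied by
    [wave_den ^+ i], which clears the poles at all finite singular endpoints; see [wave_jetE]. *)
Definition wave_num w i : {poly R} :=
  match c, w with
  | Laguerre g, WI v => 'X ^+ i * exp_poly (laguerre (g - 1 / 2) v \Po - 'X) i
  | Laguerre g, WII v => pow_poly 'X 1 (1 / 2 - g) (laguerre (1 / 2 - g) v) i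
  | Laguerre g, WP n => 'X ^+ i * (eigenP c n)^`(i)
  | Jacobi g h, WI v => (2^-1 *: (1 - 'X)) ^+ i *
      pow_poly (2^-1 *: (1 + 'X)) 2^-1 (1 / 2 - h) (jacobi (g - 1 / 2) (1 / 2 - h) v) i
  | Jacobi g h, WII v => (2^-1 *: (1 + 'X)) ^+ i *
      pow_poly (2^-1 *: (1 - 'X)) (- 2^-1) (1 / 2 - g) (jacobi (1 / 2 - g) (h - 1 / 2) v) i
  | Jacobi g h, WP n =>
      (2^-1 *: (1 - 'X)) ^+ i * (2^-1 *: (1 + 'X)) ^+ i * (eigenP c n)^`(i)
  end.

Definition wave_den : {poly R} :=
  match c with
  | Laguerre _ => 'X
  | Jacobi _ _ => (2^-1 *: (1 - 'X)) * (2^-1 *: (1 + 'X))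
  end.

Definition wave_weight w x : R :=
  match c, w with
  | Laguerre _, WI _ => expR x
  | Laguerre g, WII _ => x `^ (1 / 2 - g)
  | Jacobi g h, WI _ => ((1 + x) / 2) `^ (1 / 2 - h)
  | Jacobi g h, WII _ => ((1 - x) / 2) `^ (1 / 2 - g)
  | _, WP _ => 1
  end.

Lemma wave_jetE w i x : dom c x ->
  wave_jet c w i x = wave_den.[x] ^- i * (wave_num w i).[x] * wave_weight w x.
Proof.
rewrite /wave_den /wave_num /wave_weight /wave_jet.
have powB b y j : 0 < y -> y `^ (b - j%:R) = y `^ b / y ^+ j.
  by move=> y0; rewrite powRD ?(gt_eqF y0) ?implybT // powRN powR_mulrn // ltW.
case: c w => [g|g h] [v|v|n] /= => [x0|x0|x0|/andP[x1 x2]|/andP[x1 x2]|/andP[x1 x2]].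
- have xi : x ^+ i != 0 by rewrite expf_neq0 // gt_eqF.
  by rewrite /exp_jet hornerX hornerM hornerXn mulKf // mulrC.
- by rewrite /pow_jet hornerX powB // mulrC; ring.
- have xi : x ^+ i != 0 by rewrite expf_neq0 // gt_eqF.
  by rewrite hornerX hornerM hornerXn mulKf // mulr1.
all: have y0 : 0 < (1 + x) / 2 by lra.
all: have z0 : 0 < (1 - x) / 2 by lra.
all: have yi : ((1 + x) / 2) ^+ i != 0 by rewrite expf_neq0 // gt_eqF.
all: have zi : ((1 - x) / 2) ^+ i != 0 by rewrite expf_neq0 // gt_eqF.
all: rewrite ?/pow_jet !hornerM ?horner_exp horner_half1D horner_half1B exprMn ?powB //.
all: move: (_ ^+ i) (_ ^+ i) yi zi => Y Z y1 z1.
all: by field; rewrite y1 z1.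
Qed.

Definition num_det ws := detn (size ws) (fun i j => wave_num (nth (WP 0) ws j) i).

Definition jets_at ws x : seq (nat -> R) := [seq jet_at x F | F <- map (wave_jet c) ws].

Lemma minor_waves ws x : dom c x ->
  minor id (jets_at ws x) = (\prod_(w <- ws) wave_weight w x)
    / wave_den.[x] ^+ 'C(size ws, 2) * (num_det ws).[x].
Proof.
move=> dx; rewrite /minor !size_map horner_detn.
transitivity (detn (size ws) (fun i j => wave_den.[x] ^- i *
    (wave_num (nth (WP 0) ws j) i).[x] * wave_weight (nth (WP 0) ws j) x)).
  apply: eq_detn => i j _ lj; rewrite (nth_map (fun _ _ => 0)) ?size_map //.
  by rewrite (nth_map (WP 0)) // /jet_at wave_jetE.
rewrite (@detn_scale _ (size ws) (fun i => wave_den.[x] ^- i)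
  (fun j => wave_weight (nth (WP 0) ws j) x)).
rewrite prodfV -expr_sum [in RHS](big_nth (WP 0)) big_mkord -bin2_sum big_mkord.
by rewrite [X in X * _]mulrC.
Qed.

Lemma count_nth (P : pred wave) ws :
  count (fun j => P (nth (WP 0) ws j)) (iota 0 (size ws)) = count P ws.
Proof. by rewrite -[in RHS](mkseq_nth (WP 0) ws) count_map. Qed.

Definition z_poly : {poly R} :=
  match c with Laguerre _ => 'X | Jacobi _ _ => 2^-1 *: (1 - 'X) end.

(** Pole count at one endpoint z = 0, where [ty] marks the singular columns. A regular column fits
    [detn_pow_dvd] by taking the coefficient of z^l in row i to be 1 for l = i and 0 otherwise. *)
Lemma num_det_pow (ty : pred wave) (z : {poly R}) (A : nat -> nat -> {poly R})
    (sg : wave -> nat -> {poly R}) ws :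
    (forall w i n, (i < n)%N -> wave_num w i =
      if ty w then \sum_(l < n) A i l * z ^+ l * sg w l else z ^+ i * sg w i) ->
  exists Q, num_det ws =
    z ^+ ('C(count ty ws, 2) + 'C(count (predC ty) ws, 2)) * Q.
Proof.
move=> numE; rewrite -!count_nth.
apply: (@detn_pow_dvd _ (size ws) (fun j => ty (nth (WP 0) ws j)) z
  (fun t i l => if t then A i l else (l == i)%:R)
  (fun l j => sg (nth (WP 0) ws j) l)) => i j li _.
rewrite (numE _ _ _ li); case: ifP => // _.
rewrite (bigD1 (Ordinal li)) //= big1 => [|l /eqP ne]; first by rewrite eqxx mul1r addr0.
by case: eqP => [e|_]; [case: ne; apply: val_inj | rewrite !mul0r].
Qed.

(** The endpoint is x = 0 in case L and x = 1 in case J; the columns of type II are the singular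
    ones. *)
Lemma num_det_z ws : exists Q, num_det ws =
  z_poly ^+ ('C(count is_II ws, 2) + 'C(count (predC is_II) ws, 2)) * Q.
Proof.
apply: (@num_det_pow is_II z_poly (fun i l => match c with
    | Laguerre g => (pow_coef 1 (1 / 2 - g) i l)%:P
    | Jacobi g h => (2^-1 *: (1 + 'X)) ^+ i * (pow_coef (- 2^-1) (1 / 2 - g) i l)%:P
    end)
  (fun w l => match c, w with
    | Laguerre g, WI v => exp_poly (laguerre (g - 1 / 2) v \Po - 'X) l
    | Laguerre g, WII v => (laguerre (1 / 2 - g) v)^`(l)
    | Laguerre g, WP n => (eigenP c n)^`(l)
    | Jacobi g h, WI v =>
        pow_poly (2^-1 *: (1 + 'X)) 2^-1 (1 / 2 - h) (jacobi (g - 1 / 2) (1 / 2 - h) v) l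
    | Jacobi g h, WII v => (jacobi (1 / 2 - g) (h - 1 / 2) v)^`(l)
    | Jacobi g h, WP n => (2^-1 *: (1 + 'X)) ^+ l * (eigenP c n)^`(l)
    end)) => w i n li.
rewrite /wave_num /z_poly; case: c w => [g|g h] [v|v|k] //=; rewrite ?mulrA //.
- by rewrite (pow_polyE _ _ _ li) ?derivX.
- rewrite (pow_polyE _ _ (deriv_half1B R) li) mulr_sumr; apply: eq_bigr => l _.
  by rewrite !mulrA.
Qed.

(** At the other Jacobi endpoint, x = -1, the columns of type I are the singular ones. *)
Lemma num_det_y g h ws : c = Jacobi g h -> exists Q, num_det ws =
  (2^-1 *: (1 + 'X)) ^+ ('C(count is_I ws, 2) + 'C(count (predC is_I) ws, 2)) * Q.
Proof.
move=> cE; apply: (@num_det_pow is_I _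
  (fun i l => (2^-1 *: (1 - 'X)) ^+ i * (pow_coef 2^-1 (1 / 2 - h) i l)%:P)
  (fun w l => match w with
    | WI v => (jacobi (g - 1 / 2) (1 / 2 - h) v)^`(l)
    | WII v =>
      pow_poly (2^-1 *: (1 - 'X)) (- 2^-1) (1 / 2 - g) (jacobi (1 / 2 - g) (h - 1 / 2) v) l
    | WP n => (2^-1 *: (1 - 'X)) ^+ l * (eigenP c n)^`(l)
    end)) => w i n li.
rewrite /wave_num cE; case: w => [v|v|k] //=; last by rewrite mulrCA mulrA.
rewrite (pow_polyE _ _ (deriv_half1D R) li) mulr_sumr; apply: eq_bigr => l _.
by rewrite !mulrA.
Qed.

(* [t] is the number of columns which are not seed functions: 0 for Xi, 1 for P. *)
Definition prefactor (p q t : nat) x : R :=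
  match c with
  | Laguerre g => x `^ ((p%:R + t%:R + g - 1 / 2) * q%:R) * expR (- p%:R * x)
  | Jacobi g h => ((1 - x) / 2) `^ ((p%:R + t%:R + g - 1 / 2) * q%:R) *
                  ((1 + x) / 2) `^ ((q%:R + t%:R + h - 1 / 2) * p%:R)
  end.

Definition is_P w := if w is WP _ then true else false.

Lemma size_waves ws : size ws = (count is_I ws + count is_II ws + count is_P ws)%N.
Proof. by elim: ws => //= -[v|v|v] ws ->; rewrite /= !addnA; lia. Qed.

Lemma countC_II ws : count (predC is_II) ws = (count is_I ws + count is_P ws)%N.
Proof. by elim: ws => //= -[v|v|v] ws -> /=; lia. Qed.

Lemma countC_I ws : count (predC is_I) ws = (count is_II ws + count is_P ws)%N.
Proof. by elim: ws => //= -[v|v|v] ws -> /=; lia. Qed.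

Lemma wave_weight_prod ws x : \prod_(w <- ws) wave_weight w x =
  wave_weight (WI 0) x ^+ count is_I ws * wave_weight (WII 0) x ^+ count is_II ws.
Proof.
elim: ws => [|w ws IH]; first by rewrite big_nil mulr1.
rewrite big_cons IH; case: w => v /=; rewrite /wave_weight; case: c => *;
  rewrite ?add0n ?add1n ?exprS; ring.
Qed.

End Polynomiality.

(** The non-integral parts of the prefactor cancel the weights of the columns. Its integral
    exponents (p+t)q and (q+t)p are what is left of the pole order C(p+q+t, 2) after the powers
    dividing [num_det], by [Cz] and [Cy]. *)
Lemma poly_minor_waves (R : realType) (c : params R) ws :
  exists X : {poly R}, forall x, dom c x -> X.[x] =
    minor id (jets_at c ws x) *
    prefactor c (count is_I ws) (count is_II ws) (count is_P ws) x.
Proof.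
have [Qz] := num_det_z c ws; rewrite countC_II.
have mE x (dx : dom c x) := minor_waves ws dx.
have Ey g h (e : c = Jacobi g h) := num_det_y ws e; rewrite countC_I in Ey.
rewrite size_waves in mE; setoid_rewrite wave_weight_prod in mE.
move: mE Ey; set p := count is_I ws; set q := count is_II ws; set t := count is_P ws.
have Cz : 'C(p + q + t, 2) = ('C(q, 2) + 'C(p + t, 2) + (p + t) * q)%N.
  by rewrite addnAC bin2D; lia.
have Cy : 'C(p + q + t, 2) = ('C(p, 2) + 'C(q + t, 2) + (q + t) * p)%N.
  by rewrite -addnA bin2D; lia.
have expE (g : R) (P Q : nat) : (P%:R + t%:R + g - 1 / 2) * Q%:R
    = ((P + t) * Q)%:R - (1 / 2 - g) * Q%:R.
  by rewrite natrM natrD; field.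
rewrite /prefactor /wave_weight /wave_den /z_poly.
case: c => [g|g h] mE Ey Ez.
  exists Qz => x x0; rewrite mE // Ez hornerM horner_exp hornerX expE powR_natB //.
  rewrite mulNr expRN expRM_natl Cz exprD.
  have b0 : x `^ (1 / 2 - g) ^+ q != 0 by rewrite expf_neq0 // gt_eqF // powR_gt0.
  have e0 : expR x ^+ p != 0 by rewrite expf_neq0 // gt_eqF // expR_gt0.
  have xk k : x ^+ k != 0 by rewrite expf_neq0 // gt_eqF.
  have cancel (a b u v Q : R) : a != 0 -> b != 0 -> u != 0 -> v != 0 ->
      Q = u * v / (a * b) * (a * Q) * (b / v / u).
    by move=> a1 b1 u1 v1; field; rewrite a1 b1 u1 v1.
  exact: cancel.
have [Qy] := Ey g h erefl; rewrite Ez => ezy.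
(* The two endpoint factors add up to 1, so their powers are coprime and the two divisibilities
   combine. *)
have cop k l : coprimep ((2^-1 *: (1 + 'X)) ^+ k : {poly R}) ((2^-1 *: (1 - 'X)) ^+ l).
  apply/coprimep_expl/coprimep_expr/Bezout_eq1_coprimepP; exists (1, 1).
  rewrite !mul1r -scalerDr addrACA subrr addr0.
  have -> : 1 + 1 = 2%:P :> {poly R} by rewrite -polyCD.
  by rewrite -mul_polyC -polyCM mulVf // pnatr_eq0.
have := dvdp_mulr Qy (dvdpp ((2^-1 *: (1 + 'X)) ^+ ('C(p, 2) + 'C(q + t, 2)))).
rewrite -ezy Gauss_dvdpr // => /dvdpP[Q QE].
exists Q => x dx; rewrite mE // Ez QE.
have y0 : 0 < (1 + x) / 2 by move: dx => /= /andP[*]; lra.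
have z0 : 0 < (1 - x) / 2 by move: dx => /= /andP[*]; lra.
rewrite !hornerM !horner_exp horner_half1D horner_half1B !expE !powR_natB //.
rewrite exprMn {1}Cz Cy.
have pow0 u k : 0 < u -> u ^+ k != 0 :> R by move=> u0; rewrite expf_neq0 // gt_eqF.
have cancel (a b a' b' u v P : R) : a != 0 -> b != 0 -> a' != 0 -> b' != 0 ->
    u != 0 -> v != 0 ->
    P = u * v / (a * b * (a' * b')) * (a * (P * a')) * (b / v * (b' / u)).
  by move=> a1 b1 a1' b1' u1 v1; field; rewrite a1 b1 a1' b1' u1 v1.
move: ('C(q, 2) + _)%N ('C(p, 2) + _)%N ((p + t) * q)%N ((q + t) * p)%N => a b k l.
by rewrite !exprD; apply: cancel; apply: pow0 => //; apply: powR_gt0.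
Qed.

(** * Prefactors *)

Definition waves (A : index_pair) : seq wave := map WI (typeI A) ++ map WII (typeII A).

Section Gauge.
Variables (R : realType) (c : params R).
Implicit Types (w : wave) (ws : seq wave) (x : R).

Lemma wronskian_waves ws x : dom c x ->
  wronskian (map (wave_fun c) ws) x = wr (jets_at c ws x).
Proof.
move=> dx; rewrite /wronskian /wr /minor !size_map.
transitivity (detn (size ws)
  (fun i j => derive1n i (nth (fun=> 0) (map (wave_fun c) ws) j) x)) => //.
apply: eq_detn => i j _ lj.
rewrite (nth_map (WP 0)) // (nth_map (fun _ _ => 0)) ?size_map // (nth_map (WP 0)) //.
rewrite /jet_at; apply/esym.
exact: (derive1n_jet (@wave_jet_jet _ c _) (fun y _ => wave_jet0 c _ y)).
Qed.

Lemma nth_wave_jet ws j : (j < size (map (wave_jet c) ws))%N ->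
  jet c (nth (fun _ _ => 0) (map (wave_jet c) ws) j).
Proof.
by rewrite size_map => lj; rewrite (nth_map (WP 0)) //; apply: wave_jet_jet.
Qed.

Lemma derives_wr ws : (0 < size ws)%N ->
  derives c (fun x => wr (jets_at c ws x)) (fun x => wr1 (jets_at c ws x)).
Proof.
move=> s0; apply: eq_derives (derives_minor id (@nth_wave_jet ws)) => // x _.
have sz : size (jets_at c ws x) = (size ws).-1.+1 by rewrite !size_map prednK.
by rewrite /wr1 sz -(minor_incr_id sz) size_map prednK.
Qed.

Lemma derives_wr1 ws :
  derives c (fun x => wr1 (jets_at c ws x)) (fun x => wr2 (jets_at c ws x)).
Proof.
apply: eq_derives (derives_minor (last1 (size ws).-1 (size ws)) (@nth_wave_jet ws)) => x _.
  by rewrite /wr1 !size_map.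
by rewrite /wr2 !size_map.
Qed.

Lemma derivesV f g : (forall x, dom c x -> f x != 0) -> derives c f g ->
  derives c (fun x => (f x)^-1) (fun x => - g x / f x ^+ 2).
Proof.
move=> f0 d x dx; apply: is_derive_eq; first exact: is_deriveV (f0 x dx) (d x dx).
by rewrite /GRing.scale /= mulNr mulNr mulrC.
Qed.

Definition logd (p q t : nat) x : R :=
  match c with
  | Laguerre g => (p%:R + t%:R + g - 1 / 2) * q%:R / x - p%:R
  | Jacobi g h => (q%:R + t%:R + h - 1 / 2) * p%:R / (1 + x)
                  - (p%:R + t%:R + g - 1 / 2) * q%:R / (1 - x)
  end.

Definition dlogd (p q t : nat) x : R :=
  match c with
  | Laguerre g => - ((p%:R + t%:R + g - 1 / 2) * q%:R) / x ^+ 2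
  | Jacobi g h => - ((q%:R + t%:R + h - 1 / 2) * p%:R) / (1 + x) ^+ 2
                  - (p%:R + t%:R + g - 1 / 2) * q%:R / (1 - x) ^+ 2
  end.

End Gauge.

Section Prefactor.
Variable R : realType.

Lemma derives_logd (c : params R) p q t : derives c (logd c p q t) (dlogd c p q t).
Proof.
have aff (l : {poly R}) (k b : R) (f : R -> R) : (forall x, l.[x] = f x) ->
    (forall x, dom c x -> f x != 0) -> l^`() = b%:P ->
    derives c (fun x => k / f x) (fun x => - (k * b) / f x ^+ 2).
  move=> lf f0 dl.
  have d : derives c f (fun=> b).
    apply: eq_derives (@derives_horner _ c l) => x dx; first exact: lf.
    by rewrite dl hornerC.
  apply: eq_derives (derivesM (@derives_cst _ c k) (derivesV f0 d)) => x dx //.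
  by rewrite mul0r add0r; ring.
case: c aff => [g|g h] aff; rewrite /logd /dlogd.
  have d := aff 'X ((p%:R + t%:R + g - 1 / 2) * q%:R) 1 id.
  apply: eq_derives (derivesD (d _ _ _) (@derives_cst _ _ (- p%:R))) => //.
  - by move=> x dx /=; rewrite addr0 mulr1 mulNr.
  - by move=> x; rewrite hornerX.
  - by move=> x /= x0; rewrite gt_eqF.
  - by rewrite derivX.
have d1 := aff (1 + 'X) ((q%:R + t%:R + h - 1 / 2) * p%:R) 1 (fun x => 1 + x).
have d2 := aff (1 - 'X) (- ((p%:R + t%:R + g - 1 / 2) * q%:R)) (-1) (fun x => 1 - x).
apply: eq_derives (derivesD (d1 _ _ _) (d2 _ _ _)).
- by move=> x dx /=; rewrite [X in _ + X]mulNr.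
- by move=> x dx /=; rewrite mulrN1 opprK mulr1 [X in _ + X]mulNr.
- by move=> x; rewrite hornerD hornerX hornerC.
- by move=> x /= /andP[x1 x2]; rewrite gt_eqF //; lra.
- by rewrite derivD derivX derivC add0r.
- by move=> x; rewrite hornerD hornerN hornerX hornerC.
- by move=> x /= /andP[x1 x2]; rewrite gt_eqF //; lra.
- by rewrite derivB derivX derivC sub0r polyCN.
Qed.

Lemma derives_prefactor (c : params R) p q t : derives c (prefactor c p q t)
  (fun x => logd c p q t x * prefactor c p q t x).
Proof.
case: c => [g|g h]; rewrite /prefactor /logd.
  have de : derives (Laguerre g) (fun x => expR (- p%:R * x))
      (fun x => - p%:R * expR (- p%:R * x)).
    have d : derives (Laguerre g) (@expR R \o horner (- p%:R *: 'X))
        (fun x => expR (- p%:R *: 'X).[x] * (- p%:R *: 'X)^`().[x]).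
      by move=> x _; exact: is_derive1_comp.
    apply: eq_derives d => x _ /=; first by rewrite hornerZ hornerX.
    by rewrite derivZ derivX !hornerZ hornerX hornerC; ring.
  have dp := @derives_powR _ (Laguerre g) 'X 1 ((p%:R + t%:R + g - 1 / 2) * q%:R).
  apply: eq_derives (derivesM (dp _ _) de).
  - by move=> x _; rewrite hornerX.
  - move=> x /= x0; rewrite hornerX (powRS ((p%:R + t%:R + g - 1 / 2) * q%:R) x0).
    by field; rewrite gt_eqF.
  - by rewrite derivX.
  - by move=> x; rewrite hornerX.
have dz := @derives_powR _ (Jacobi g h) (2^-1 *: (1 - 'X)) (- 2^-1)
  ((p%:R + t%:R + g - 1 / 2) * q%:R) (deriv_half1B R).
have dy := @derives_powR _ (Jacobi g h) (2^-1 *: (1 + 'X)) 2^-1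
  ((q%:R + t%:R + h - 1 / 2) * p%:R) (deriv_half1D R).
apply: eq_derives (derivesM (dz _) (dy _)).
- by move=> x _; rewrite horner_half1D horner_half1B.
- move=> x /= /andP[x1 x2]; rewrite horner_half1D horner_half1B.
  have y0 : 0 < (1 + x) / 2 by lra.
  have z0 : 0 < (1 - x) / 2 by lra.
  rewrite (powRS ((q%:R + t%:R + h - 1 / 2) * p%:R) y0).
  rewrite (powRS ((p%:R + t%:R + g - 1 / 2) * q%:R) z0); field.
  by rewrite !gt_eqF //; lra.
- by move=> x /= /andP[*]; rewrite horner_half1B; lra.
- by move=> x /= /andP[*]; rewrite horner_half1D; lra.
Qed.
End Prefactor.

Section Gauged.
Variables (R : realType) (c : params R).
Implicit Types (ws : seq wave) (x : R).

(** The prefactor enters through its logarithmic derivative r and the derivative of r. The constant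
    [eps] is meant for the sign of a reordering of columns. *)
Lemma gauged_derivatives ws (X : {poly R}) (eps : R) p q t : (0 < size ws)%N ->
    (forall x, dom c x -> X.[x] = eps * wr (jets_at c ws x) * prefactor c p q t x) ->
  forall x, dom c x ->
    let W := wr (jets_at c ws x) in let W1 := wr1 (jets_at c ws x) in
    let W2 := wr2 (jets_at c ws x) in
    let h := eps * prefactor c p q t x in
    let r := logd c p q t x in
    [/\ X.[x] = h * W, X^`().[x] = h * (W1 + r * W)
      & X^`()^`().[x] = h * (W2 + 2 * r * W1 + (dlogd c p q t x + r ^+ 2) * W)].
Proof.
move=> s0 XE x dx W W1 W2 h r.
have d1 : derives c (fun x => eps * wr (jets_at c ws x) * prefactor c p q t x)
  (fun x => eps * (wr1 (jets_at c ws x) + logd c p q t x * wr (jets_at c ws x))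
     * prefactor c p q t x).
  have := derivesM (derivesM (@derives_cst _ c eps) (derives_wr s0))
    (@derives_prefactor _ c p q t).
  by apply: eq_derives => // y dy; ring.
have E1 := derives_unique XE (@derives_horner _ c X) d1.
have d2 : derives c (fun x => eps * (wr1 (jets_at c ws x)
      + logd c p q t x * wr (jets_at c ws x)) * prefactor c p q t x)
  (fun x => eps * prefactor c p q t x * (wr2 (jets_at c ws x)
     + 2 * logd c p q t x * wr1 (jets_at c ws x)
     + (dlogd c p q t x + logd c p q t x ^+ 2) * wr (jets_at c ws x))).
  have := derivesM (derivesM (@derives_cst _ c eps) (derivesD (@derives_wr1 _ c ws)
    (derivesM (@derives_logd _ c p q t) (derives_wr s0))))
    (@derives_prefactor _ c p q t).
  by apply: eq_derives => // y dy; ring.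
have E2 := derives_unique E1 (@derives_horner _ c X^`()) d2.
split; rewrite ?XE ?E1 ?E2 //; rewrite /h /W /W1 /r; ring.
Qed.

End Gauged.

(** * Coefficients of the operator after removal of the prefactors *)

Section Coefficients.
Variables (R : realType) (c : params R).
Implicit Types (x : R) (p q : nat).

(** The term i(i-1)/2 c2'' + i c1' of [ode_jet_at], with c2'' = 0, c1' = -1 in case L and c2'' = -2,
    c1' = -(g+h+1) in case J. *)
Definition ode_shift (i : nat) : R :=
  match c with
  | Laguerre _ => - i%:R
  | Jacobi g h => - (i%:R * (i%:R - 1)) - i%:R * (g + h + 1)
  end.

Lemma horner_c1 (c' : params R) x : (c1 c').[x] = match c' with
  | Laguerre g => g + 1 / 2 - x | Jacobi g h => h - g - (g + h + 1) * x end.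
Proof.
by case: c' => [g|g h] /=; rewrite hornerD hornerN ?hornerZ hornerX hornerC.
Qed.

Lemma horner_c2 x :
  (c2 c).[x] = match c with Laguerre _ => x | Jacobi _ _ => 1 - x ^+ 2 end.
Proof.
by case: c => [g|g h] /=; rewrite ?hornerD ?hornerN ?hornerXn ?hornerX ?hornerC.
Qed.

Lemma horner_deriv_c2 x :
  (c2 c)^`().[x] = match c with Laguerre _ => 1 | Jacobi _ _ => - 2 * x end.
Proof.
case: c => [g|g h] /=; first by rewrite derivX hornerC.
by rewrite derivB derivC derivXn sub0r hornerN hornerMn hornerXn -mulr_natl mulNr.
Qed.

Lemma wave_ode_jet w x : dom c x ->
  ode_jet (c2 c).[x] (c2 c)^`().[x] (c1 c).[x] ode_shift (- (wave_energy c w / 4))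
    (jet_at x (wave_jet c w)).
Proof.
move=> dx; have jw := @wave_jet_jet R c w; have ode y dy := @wave_ode R c w y dy.
move: jw ode dx; rewrite /ode_shift; case: c => [g|g h] jw ode dx.
  have := @ode_jet_at _ (Laguerre g) _ 'X _ 0 (-1) _ jw _ _ ode _ dx.
  rewrite derivX derivC derivB derivC derivX sub0r polyCN => /(_ erefl erefl) o i.
  by rewrite -(o i) mulr0 add0r mulrN1.
have e2 : (1 - 'X^2 : {poly R})^`()^`() = (- 2)%:P.
  by rewrite derivB derivC derivXn sub0r derivN derivMn derivX polyCN polyC_natr.
have e1 : ((h - g)%:P - (g + h + 1) *: 'X)^`() = (- (g + h + 1))%:P.
  by rewrite derivB derivC derivZ derivX sub0r alg_polyC polyCN.
have o := @ode_jet_at _ (Jacobi g h) _ (1 - 'X^2) _ (- 2) (- (g + h + 1)) _ jw e2 e1 ode _ dx.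
by move=> i; rewrite -(o i); congr (_ + _ * _); field.
Qed.

(** The parameter shifts in [C1] and [C1m] are such that the prefactors of Xi_D and P_D' turn them
    into the coefficients of [bilinear_replace], with p + q = size S + 1. *)
Lemma coef_replace p q x : dom c x ->
  let C := (c1 (Defs.shift c (p%:R - q%:R) (- p%:R + q%:R))).[x] in
  let Cm := (c1 (Defs.shift c (p%:R - q%:R - 1) (- p%:R + q%:R - 1))).[x] in
  let r0 := logd c p q 0 x in let r1 := logd c p q 1 x in
  [/\ 2 * (c2 c).[x] * (r1 - r0) + C = (p + q)%:R * (c2 c)^`().[x] + (c1 c).[x],
      2 * (c2 c).[x] * (r1 - r0) + Cm
        = ((p + q)%:R - 1) * (c2 c)^`().[x] + (c1 c).[x]
    & (c2 c).[x] * ((r1 - r0) ^+ 2 + dlogd c p q 1 x + dlogd c p q 0 x)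
        + C * r1 - Cm * r0 = ode_shift (p + q)].
Proof.
rewrite !horner_c1 horner_c2 horner_deriv_c2 /ode_shift /logd /dlogd natrD.
case: c => [g|g h] /= dx.
  by split; field; rewrite gt_eqF.
have y0 : 1 + x != 0 by case/andP: dx => *; rewrite gt_eqF //; lra.
have z0 : 1 - x != 0 by case/andP: dx => *; rewrite gt_eqF //; lra.
by split; field; rewrite y0 z0.
Qed.

(** The counterpart for [bilinear_remove], with p + q = size S. The signs are reversed because Xi_D
    is now the Wronskian with more columns than that of P_D'. *)
Lemma coef_remove p q x : dom c x ->
  let C := (c1 (Defs.shift c (p.+1%:R - q.+1%:R) (- p.+1%:R + q.+1%:R))).[x] in
  let Cm := (c1 (Defs.shift c (p.+1%:R - q.+1%:R - 1) (- p.+1%:R + q.+1%:R - 1))).[x] in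
  let r0 := logd c p.+1 q.+1 0 x in let r1 := logd c p q 1 x in
  [/\ 2 * (c2 c).[x] * (r1 - r0) + C = - ((p + q)%:R * (c2 c)^`().[x] + (c1 c).[x]),
      2 * (c2 c).[x] * (r1 - r0) + Cm
        = - ((p + q).+1%:R * (c2 c)^`().[x] + (c1 c).[x])
    & (c2 c).[x] * ((r1 - r0) ^+ 2 + dlogd c p q 1 x + dlogd c p.+1 q.+1 0 x)
        + C * r1 - Cm * r0 = ode_shift (p + q).+1].
Proof.
rewrite !horner_c1 horner_c2 horner_deriv_c2 /ode_shift /logd /dlogd -!natr1 natrD.
case: c => [g|g h] /= dx.
  by split; field; rewrite gt_eqF.
have y0 : 1 + x != 0 by case/andP: dx => *; rewrite gt_eqF //; lra.
have z0 : 1 - x != 0 by case/andP: dx => *; rewrite gt_eqF //; lra.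
by split; field; rewrite y0 z0.
Qed.

End Coefficients.

(** * The bilinear identity for the polynomials *)

Lemma clear_denominators (K : fieldType) (x x1 x2 y y1 y2 a b d e : K) : x != 0 ->
  x * (- 4 * (a * y2 + (b - 2 * a * (x1 / x)) * y1
              + (a * (x2 / x) - d * (x1 / x)) * y) - e * y)
  = - 4 * (a * (x * y2 - 2 * x1 * y1 + x2 * y) + b * x * y1 - d * x1 * y) - e * x * y.
Proof. by move=> x0; field. Qed.

Section Final.
Variables (R : realType) (c : params R).
Implicit Types (x : R) (p q : nat) (X P : {poly R}) (S : seq wave).

Lemma poly_eq_dom X P : (forall x, dom c x -> X.[x] = P.[x]) -> X = P.
Proof.
move=> e; apply/eqP; rewrite -subr_eq0; apply/eqP/eqP; apply: contraT => n0.
(* The points 1/(i+2) lie in the domain in both cases, and provide more roots than the degree of the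
   difference allows. *)
pose u i : R := i.+2%:R^-1.
have u_dom i : dom c (u i).
  have u0 : 0 < u i by rewrite invr_gt0 ltr0n.
  have u1 : u i < 1 by rewrite invf_lt1 ?ltr0n // ltr1n.
  by case: c => [g|g h] //=; apply/andP; split; lra.
have := @max_poly_roots _ _ (map u (iota 0 (size (X - P)))) n0.
rewrite size_map size_iota ltnn => -> //.
  by apply/allP => _ /mapP[i _ ->]; rewrite rootE hornerD hornerN e // subrr.
rewrite map_inj_uniq ?iota_uniq // => i j /invr_inj /eqP.
by rewrite eqr_nat => /eqP [].
Qed.

(** The operator multiplied by -X/4, hence without denominators; its leading part is the Hirota
    derivative of second order. *)
Definition hirota (C Cm X P : {poly R}) : {poly R} :=
  c2 c * (X * P^`()^`() - 2 * X^`() * P^`() + X^`()^`() * P)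
  + C * X * P^`() - Cm * X^`() * P.

Lemma Htilde_hirota D X P (Y : {poly R}) (e : R) :
  (- 4)%:P * hirota (C1 c D) (C1m c D) X P - e%:P * X * P = Y ->
  X%:F * (Htilde c D X P - (e%:P)%:F * P%:F) = Y%:F.
Proof.
(* For X = 0 denominators cannot be cleared, but both sides vanish. *)
rewrite polyCN polyC_natr => <-; have [->|X0] := eqVneq X 0.
  rewrite tofrac0 mul0r /hirota !deriv0.
  by rewrite [X in X%:F](_ : _ = 0) ?tofrac0 //; ring.
have F0 : X%:F != 0 by rewrite tofrac_eq0.
rewrite /Htilde /hirota !derivnS /=.
rewrite !(tofracB, tofracD, tofracM, tofracN) ?tofracMn ?tofrac1.
exact: clear_denominators.
Qed.

(** The leading part keeps its form under multiplication by prefactors: their logarithmic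
    derivatives r and s only alter the coefficients of lower order. *)
Lemma gauge_hirota C Cm X P x h k w w1 w2 v v1 v2 r s r' s' :
  X.[x] = h * w -> X^`().[x] = h * (w1 + r * w) ->
  X^`()^`().[x] = h * (w2 + 2 * r * w1 + (r' + r ^+ 2) * w) ->
  P.[x] = k * v -> P^`().[x] = k * (v1 + s * v) ->
  P^`()^`().[x] = k * (v2 + 2 * s * v1 + (s' + s ^+ 2) * v) ->
  (hirota C Cm X P).[x] = h * k * ((c2 c).[x] * (w * v2 - 2 * w1 * v1 + w2 * v)
    + (2 * (c2 c).[x] * (s - r) + C.[x]) * w * v1
    - (2 * (c2 c).[x] * (s - r) + Cm.[x]) * w1 * v
    + ((c2 c).[x] * ((s - r) ^+ 2 + s' + r') + C.[x] * s - Cm.[x] * r) * w * v).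
Proof.
move=> X0 X1 X2 P0 P1 P2; rewrite /hirota.
rewrite !(hornerD, hornerN, hornerM) ?hornerMn !hornerC X0 X1 X2 P0 P1 P2.
by ring.
Qed.

(** The zeroth-order term [s] produced by the prefactors cancels the one of the bilinear identity,
    and E = -4u converts the eigenvalues into energies. *)
Lemma bilinear_conclude (h k a A1 A0 w w1 w2 v v1 v2 s u f E : R) :
  a * (w * v2 - 2 * w1 * v1 + w2 * v) + A1 * w * v1 - A0 * w1 * v
    = (u - s) * (w * v) + f -> E = - 4 * u ->
  - 4 * (h * k * (a * (w * v2 - 2 * w1 * v1 + w2 * v)
      + A1 * w * v1 - A0 * w1 * v + s * w * v)) - E * (h * w) * (k * v)
  = - 4 * (h * k) * f.
Proof. by move=> -> ->; ring. Qed.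

Lemma bilinear_concludeN (h k a A1 A0 w w1 w2 v v1 v2 s u f E : R) :
  a * (w * v2 - 2 * w1 * v1 + w2 * v) + A0 * w1 * v - A1 * w * v1
    = f + (u - s) * (w * v) -> E = - 4 * u ->
  - 4 * (h * k * (a * (w * v2 - 2 * w1 * v1 + w2 * v)
      + - A1 * w * v1 - - A0 * w1 * v + s * w * v)) - E * (h * w) * (k * v)
  = - 4 * (h * k) * f.
Proof.
by move=> e; apply: bilinear_conclude; rewrite addrC in e; rewrite -[RHS]addrC -e; ring.
Qed.

Let J S x := jets_at c S x.
Let kap w : R := - (wave_energy c w / 4).

Lemma ode_jets S x : dom c x -> forall j, (j < size (J S x))%N ->
  ode_jet (c2 c).[x] (c2 c)^`().[x] (c1 c).[x] (ode_shift c)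
    (kap (nth (WP 0) S j)) (nth (fun=> 0) (J S x) j).
Proof.
move=> dx j; rewrite /J /jets_at !size_map => lj.
rewrite (nth_map (fun _ _ => 0)) ?size_map // (nth_map (WP 0)) //.
exact: wave_ode_jet.
Qed.

Lemma jets_rcons S w x : J (rcons S w) x = rcons (J S x) (jet_at x (wave_jet c w)).
Proof. by rewrite /J /jets_at !map_rcons. Qed.

Lemma jets_cat S T x : J (S ++ T) x = J S x ++ J T x.
Proof. by rewrite /J /jets_at !map_cat. Qed.

(** The replacement occurs in the same position, so moving that column behind the common ones gives
    the four Wronskians the same sign [eps], which occurs squared on both sides. *)
Lemma hirota_replace S wd we n p q (eps : R) X X' P P' :
    (p + q)%N = (size S).+1 ->
    (forall x, dom c x -> X.[x] = eps * wr (J (rcons S wd) x) * prefactor c p q 0 x) ->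
    (forall x, dom c x -> X'.[x] = eps * wr (J (rcons S we) x) * prefactor c p q 0 x) ->
    (forall x, dom c x ->
       P.[x] = eps * wr (J (S ++ [:: wd; WP n]) x) * prefactor c p q 1 x) ->
    (forall x, dom c x ->
       P'.[x] = eps * wr (J (S ++ [:: we; WP n]) x) * prefactor c p q 1 x) ->
  (- 4)%:P * hirota (c1 (Defs.shift c (p%:R - q%:R) (- p%:R + q%:R)))
      (c1 (Defs.shift c (p%:R - q%:R - 1) (- p%:R + q%:R - 1))) X P'
    - (wave_energy c wd + wave_energy c we - energy c n)%:P * X * P'
  = (2 * (energy c n - wave_energy c we))%:P * P * X'.
Proof.
move=> pq XE XE' PE PE'; apply: poly_eq_dom => x dx.
have [|X0 X1 X2] := gauged_derivatives _ XE dx; first by rewrite size_rcons.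
have [|P0 P1 P2] := gauged_derivatives _ PE' dx; first by rewrite size_cat addn2.
have [e1 e2 e3] := @coef_replace _ c p q x dx.
have B := bilinear_replace (@ode_jets S x dx) (@wave_ode_jet _ c wd x dx)
   (@wave_ode_jet _ c we x dx) (@wave_ode_jet _ c (WP n) x dx).
have E0 := gauge_hirota _ _ X0 X1 X2 P0 P1 P2.
rewrite !hornerD !hornerN !hornerM !hornerC E0 X0 P0 PE // XE' //.
rewrite e1 e2 e3 pq; rewrite -!/(J _ _) !jets_rcons !jets_cat.
have sJ : size (J S x) = size S by rewrite /J /jets_at !size_map.
have nS : (size S).+1%:R = (size S)%:R + 1 :> R by rewrite natr1.
rewrite sJ nS in B; rewrite nS addrK.
rewrite (bilinear_conclude _ _ B) /=; last by field.
by field.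
Qed.

Lemma powR_shift (u a b d e : R) : 0 < u -> a + b = 1 + (d + e) ->
  u `^ a * u `^ b = u * (u `^ d * u `^ e).
Proof.
move=> u0 ab; have u1 t : t ==> (u != 0) by rewrite (gt_eqF u0) implybT.
by rewrite -!powRD // ab (@powRD _ u 1) // powRr1 // ltW.
Qed.

(** This gives the constants of type III: the factor -4 of the operator times the 2 c2 of
    [bilinear_remove] yields -8, and -32 in case J, where the product of (1-x)/2 and (1+x)/2 is
    c2/4. *)
Lemma prefactor_remove p q x : dom c x ->
  prefactor c p.+1 q.+1 1 x * prefactor c p q 0 x =
  (c2 c).[x] / (if c is Laguerre _ then 1 else 4)
    * (prefactor c p.+1 q.+1 0 x * prefactor c p q 1 x).
Proof.
rewrite horner_c2 /prefactor; case: c => [g|g h] /= dx.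
  rewrite [LHS]mulrACA (powR_shift dx (d := (p.+1%:R + 0%:R + g - 1 / 2) * q.+1%:R)
    (e := (p%:R + 1%:R + g - 1 / 2) * q%:R)); last by rewrite -!natr1; ring.
  by rewrite divr1; ring.
have y0 : 0 < (1 + x) / 2 by case/andP: dx => *; lra.
have z0 : 0 < (1 - x) / 2 by case/andP: dx => *; lra.
have -> : (1 - x ^+ 2) / 4 = (1 - x) / 2 * ((1 + x) / 2) by field.
rewrite [LHS]mulrACA (powR_shift z0 (d := (p.+1%:R + 0%:R + g - 1 / 2) * q.+1%:R)
  (e := (p%:R + 1%:R + g - 1 / 2) * q%:R)); last by rewrite -!natr1; ring.
rewrite (powR_shift y0 (d := (q.+1%:R + 0%:R + h - 1 / 2) * p.+1%:R)
  (e := (q%:R + 1%:R + h - 1 / 2) * p%:R)); last by rewrite -!natr1; ring.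
by ring.
Qed.

(** Only Xi_D and P_D contain the columns that are moved, so [eps] occurs once on each side. *)
Lemma hirota_remove S wd we n p q (eps : R) X X' P P' :
    size S = (p + q)%N ->
    (forall x, dom c x ->
       X.[x] = eps * wr (J (S ++ [:: wd; we]) x) * prefactor c p.+1 q.+1 0 x) ->
    (forall x, dom c x -> X'.[x] = wr (J S x) * prefactor c p q 0 x) ->
    (forall x, dom c x ->
       P.[x] = eps * wr (J (S ++ [:: wd; we; WP n]) x) * prefactor c p.+1 q.+1 1 x) ->
    (forall x, dom c x -> P'.[x] = wr (J (rcons S (WP n)) x) * prefactor c p q 1 x) ->
  (- 4)%:P * hirota (c1 (Defs.shift c (p.+1%:R - q.+1%:R) (- p.+1%:R + q.+1%:R)))
      (c1 (Defs.shift c (p.+1%:R - q.+1%:R - 1) (- p.+1%:R + q.+1%:R - 1))) X P'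
    - (wave_energy c wd + wave_energy c we - energy c n)%:P * X * P'
  = (if c is Laguerre _ then - 8 else - 32)%:P * P * X'.
Proof.
move=> pq XE XE' PE PE'; apply: poly_eq_dom => x dx.
have PE1 y : dom c y -> P'.[y] = 1 * wr (J (rcons S (WP n)) y) * prefactor c p q 1 y.
  by move=> dy; rewrite mul1r PE'.
have [|X0 X1 X2] := gauged_derivatives _ XE dx; first by rewrite size_cat addn2.
have [|P0 P1 P2] := gauged_derivatives _ PE1 dx; first by rewrite size_rcons.
have [e1 e2 e3] := @coef_remove _ c p q x dx.
have B := bilinear_remove (@ode_jets S x dx) (@wave_ode_jet _ c wd x dx)
   (@wave_ode_jet _ c we x dx) (@wave_ode_jet _ c (WP n) x dx).
have E0 := gauge_hirota _ _ X0 X1 X2 P0 P1 P2.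
rewrite !hornerD !hornerN !hornerM !hornerC E0 X0 P0 PE // XE' //.
rewrite e1 e2 e3 -pq; rewrite -!/(J _ _) !jets_rcons !jets_cat.
have sJ : size (J S x) = size S by rewrite /J /jets_at !size_map.
rewrite sJ in B; rewrite (bilinear_concludeN _ _ B) //; last by rewrite /=; field.
rewrite -[[:: jet_at _ _; jet_at _ _; _]]/(J [:: wd; we; WP n] x).
have := prefactor_remove p q dx; move: (wr (J S x)) (wr (_ ++ _)) => a b.
move: (prefactor _ _ _ _ _) (prefactor _ _ _ _ _) (prefactor _ _ _ _ _)
  (prefactor _ _ _ _ _) => h1 k0 h k pr.
rewrite -!mulrA [X in _ = _ * (_ * X)](_ : _ = b * a * (k * h)); last by ring.
by rewrite pr; case: c => *; field.
Qed.

End Final.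

(** * From index pairs to lists of columns *)

Section IndexPairs.
Variables (R : realType) (c : params R).
Implicit Types (A D : index_pair) (S T : seq wave) (x : R).

Lemma size_waves_pair A : size (waves A) = (size (typeI A) + size (typeII A))%N.
Proof. by rewrite size_cat !size_map. Qed.

Lemma count_waves A : [/\ count is_I (waves A) = size (typeI A),
  count is_II (waves A) = size (typeII A) & count is_P (waves A) = 0%N].
Proof.
have cst (f : nat -> wave) (P : pred wave) b s : (forall v, P (f v) = b) ->
    count P (map f s) = (b * size s)%N.
  by move=> Pf; elim: s => [|v s IH] /=; rewrite ?muln0 // Pf IH mulnS.
rewrite /waves !count_cat; split.
- by rewrite (@cst _ _ true) // (@cst _ _ false) // mul1n mul0n addn0.
- by rewrite (@cst _ _ false) // (@cst _ _ true) // mul1n mul0n.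
- by rewrite !(@cst _ _ false).
Qed.

Lemma Xi_funE A x : dom c x -> Xi_fun c A x =
  wr (jets_at c (waves A) x) * prefactor c (size (typeI A)) (size (typeII A)) 0 x.
Proof.
move=> dx; rewrite /Xi_fun -wronskian_waves // /seeds /waves map_cat -!map_comp.
by rewrite /prefactor; case: c => [g|g h]; rewrite !addr0.
Qed.

Lemma P_funE A n x : dom c x -> P_fun c A n x =
  wr (jets_at c (rcons (waves A) (WP n)) x)
    * prefactor c (size (typeI A)) (size (typeII A)) 1 x.
Proof.
move=> dx; rewrite /P_fun -wronskian_waves // map_rcons /seeds /waves map_cat -!map_comp.
have half (a b : R) : a + b + 1 / 2 = a + 1 + b - 1 / 2 by field.
by rewrite /prefactor; case: c => [g|g h]; rewrite !half.
Qed.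

Lemma Xi_poly A : exists X, poly_of c (Xi_fun c A) X.
Proof.
have [X XE] := poly_minor_waves c (waves A); exists X => x dx.
by rewrite XE // Xi_funE //; have [-> -> ->] := count_waves A.
Qed.

Lemma P_poly A n : exists P, poly_of c (P_fun c A n) P.
Proof.
have [P PE] := poly_minor_waves c (rcons (waves A) (WP n)); exists P => x dx.
rewrite PE // P_funE // -cats1 !(count_cat _ (waves A)).
by have [-> -> ->] := count_waves A; rewrite /= !addn0.
Qed.

Lemma wr_move S1 w S2 T x : wr (jets_at c (S1 ++ w :: S2 ++ T) x) =
  (-1) ^+ size S2 * wr (jets_at c (S1 ++ S2 ++ w :: T) x).
Proof.
rewrite /wr /jets_at !map_cat !map_cons !map_cat minor_move.
by rewrite !size_map.
Qed.

Lemma replace_identity D D' S1 S2 wd we n X X' P P' :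
    waves D = S1 ++ wd :: S2 -> waves D' = S1 ++ we :: S2 ->
    size (typeI D') = size (typeI D) -> size (typeII D') = size (typeII D) ->
    poly_of c (Xi_fun c D) X -> poly_of c (Xi_fun c D') X' ->
    poly_of c (P_fun c D n) P -> poly_of c (P_fun c D' n) P' ->
  X%:F * (Htilde c D X P'
    - ((wave_energy c wd + wave_energy c we - energy c n)%:P)%:F * P'%:F)
  = ((2 * (energy c n - wave_energy c we))%:P * P * X')%:F.
Proof.
move=> wD wD' sI sII XE XE' PE PE'; apply: Htilde_hirota.
apply: (@hirota_replace _ c (S1 ++ S2) wd we n (size (typeI D)) (size (typeII D))
  ((-1) ^+ size S2)).
- by rewrite -size_waves_pair wD !size_cat addnS.
- move=> x dx; rewrite XE // Xi_funE // wD; congr (_ * _).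
  by have := wr_move S1 wd S2 [::] x; rewrite cats0 catA cats1.
- move=> x dx; rewrite XE' // Xi_funE // wD' sI sII; congr (_ * _).
  by have := wr_move S1 we S2 [::] x; rewrite cats0 catA cats1.
- move=> x dx; rewrite PE // P_funE // wD; congr (_ * _).
  by rewrite -cats1 -catA /= wr_move catA.
- move=> x dx; rewrite PE' // P_funE // wD' sI sII; congr (_ * _).
  by rewrite -cats1 -catA /= wr_move catA.
Qed.

Lemma remove_identity D D' (A1 A2 B2 : seq wave) wd we n X X' P P' :
    waves D = A1 ++ wd :: A2 ++ we :: B2 -> waves D' = A1 ++ A2 ++ B2 ->
    size (typeI D) = (size (typeI D')).+1 -> size (typeII D) = (size (typeII D')).+1 ->
    poly_of c (Xi_fun c D) X -> poly_of c (Xi_fun c D') X' ->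
    poly_of c (P_fun c D n) P -> poly_of c (P_fun c D' n) P' ->
  X%:F * (Htilde c D X P'
    - ((wave_energy c wd + wave_energy c we - energy c n)%:P)%:F * P'%:F)
  = ((if c is Laguerre _ then - 8 else - 32)%:P * P * X')%:F.
Proof.
move=> wD wD' sI sII XE XE' PE PE'; apply: Htilde_hirota.
(* Column [wd] passes [A2], which gives the sign; then [we] and [wd] both pass [B2], which gives
   none. *)
have mv T x : wr (jets_at c (A1 ++ wd :: A2 ++ we :: B2 ++ T) x) =
    (-1) ^+ size A2 * wr (jets_at c ((A1 ++ A2 ++ B2) ++ wd :: we :: T) x).
  rewrite wr_move; congr (_ * _).
  have := wr_move (A1 ++ A2 ++ [:: wd]) we B2 T x.
  rewrite -!catA /= => ->.
  have := wr_move (A1 ++ A2) wd B2 (we :: T) x.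
  by rewrite -!catA /= => ->; rewrite mulrA -expr2 sqrr_sign mul1r.
rewrite /C1 /C1m sI sII.
apply: (@hirota_remove _ c (A1 ++ A2 ++ B2) wd we n (size (typeI D')) (size (typeII D'))
  ((-1) ^+ size A2)).
- by rewrite -size_waves_pair wD'.
- move=> x dx; rewrite XE // Xi_funE // wD sI sII; congr (_ * _).
  by have := mv [::] x; rewrite cats0.
- by move=> x dx; rewrite XE' // Xi_funE // wD'.
- move=> x dx; rewrite PE // P_funE // wD sI sII; congr (_ * _).
  by have := mv [:: WP n] x; rewrite -cats1 -!catA /= -!catA.
- by move=> x dx; rewrite PE' // P_funE // wD'.
Qed.

End IndexPairs.

(** [replace] acts on all occurrences of d, so uniqueness has to exclude d from s1 and s2. *)
Lemma replace_cat d e s1 s2 : uniq (s1 ++ d :: s2) ->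
  replace d e (s1 ++ d :: s2) = s1 ++ e :: s2.
Proof.
rewrite cat_uniq /= => /and3P[_ /norP[ds1 _] /andP[ds2 _]].
have id s : d \notin s -> replace d e s = s.
  move=> ds; rewrite /replace -[RHS]map_id; apply/eq_in_map => y ys.
  by case: eqP ys ds => // -> ->.
by rewrite /replace map_cat /= eqxx -!/(replace _ _ _) !id.
Qed.

Lemma rem_cat d (s1 s2 : seq nat) : uniq (s1 ++ d :: s2) ->
  rem d (s1 ++ d :: s2) = s1 ++ s2.
Proof.
move=> u; have := u; rewrite cat_uniq /= => /and3P[_ /norP[ds1 _] /andP[ds2 _]].
rewrite rem_filter // filter_cat /= eqxx; congr (_ ++ _).
  by apply/all_filterP/allP => y ys; apply: contraNneq ds1 => <-.
by apply/all_filterP/allP => y ys; apply: contraNneq ds2 => <-.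
Qed.

Theorem theorem4p3 (R : realType) (c : params R) (D : index_pair) (n : nat)
    (m : modification) (hD : multi_index D) (hc : admissible c D)
    (hn : (1 <= n)%N) (hm : in_EP D m) :
  exists XiD XiD' PDn PD'n : {poly R},
    [/\ poly_of c (Xi_fun c D) XiD,
        poly_of c (Xi_fun c (modify D m)) XiD',
        poly_of c (P_fun c D n) PDn
      & poly_of c (P_fun c (modify D m) n) PD'n]
    /\ XiD%:F * (Htilde c D XiD PD'n
                   - ((Etilde c n m)%:P)%:F * PD'n%:F)
       = ((Eprime c n m)%:P * PDn * XiD')%:F.
Proof.
have [X XE] := Xi_poly c D; have [X' XE'] := Xi_poly c (modify D m).
have [P PE] := P_poly c D n; have [P' PE'] := P_poly c (modify D m) n.
exists X, X', P, P'; split=> //.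
have [sI sII _ _ _] := hD.
have uI := sorted_uniq ltn_trans ltnn sI; have uII := sorted_uniq ltn_trans ltnn sII.
case: D hD hc hm XE XE' PE PE' sI sII uI uII => I II /= _ _.
case: m => [d e|d e|d1 d2] /= hm XE XE' PE PE' _ _ uI uII.
- case/and3P: hm => dI _ _; case/splitPr: dI uI XE XE' PE PE' => s1 s2 uI.
  rewrite replace_cat // => XE XE' PE PE'.
  apply: (replace_identity (S1 := map WI s1) (S2 := map WI s2 ++ map WII II)
    (wd := WI d) (we := WI e) _ _ _ _ XE XE' PE PE') => //=.
  + by rewrite /waves /= map_cat -catA.
  + by rewrite /waves /= map_cat -catA.
  + by rewrite !size_cat.
- case/and3P: hm => dI _ _; case/splitPr: dI uII XE XE' PE PE' => s1 s2 uII.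
  rewrite replace_cat // => XE XE' PE PE'.
  apply: (replace_identity (S1 := map WI I ++ map WII s1) (S2 := map WII s2)
    (wd := WII d) (we := WII e) _ _ _ _ XE XE' PE PE') => //=.
  + by rewrite /waves /= map_cat catA.
  + by rewrite /waves /= map_cat catA.
  + by rewrite !size_cat.
- case/andP: hm => dI dII; case/splitPr: dI uI XE XE' PE PE' => s1 s2 uI.
  case/splitPr: dII uII => r1 r2 uII; rewrite !rem_cat // => XE XE' PE PE'.
  (* Between the two removed columns stand the end of type I and the beginning of type II. *)
  apply: (remove_identity (A1 := map WI s1) (A2 := map WI s2 ++ map WII r1)
    (B2 := map WII r2) (wd := WI d1) (we := WII d2) _ _ _ _ XE XE' PE PE') => //=.
  + by rewrite /waves /= !map_cat -!catA.
  + by rewrite /waves /= !map_cat -!catA.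
  + by rewrite !size_cat addnS.
  + by rewrite !size_cat addnS.
Qed.
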